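(* Let $\mathbb X=\mathbb T^d=\mathbb R^d/\mathbb Z^d$ with $d\ge2$, let $s>d/2$, and let $K$ be a continuous symmetric positive definite kernel on $\mathbb T^d$ with $H_K(\mathbb T^d)=H^s(\mathbb T^d)$ with equivalent norms. Then for every $\mu\in\mathcal P(\mathbb T^d)$ absolutely continuous with positive density $\rho\in H^s(\mathbb T^d)$ there is a constant $c>0$, depending on $d$, $K$ and $\rho$, such that for all $L\ge1$ $$\min_{\nu\in\mathcal P^{\mathrm{Acurve}}_L(\mathbb T^d)}\mathscr D_K(\mu,\nu)\le\min_{\nu\in\mathcal P^{\mathrm{Lcurve}}_L(\mathbb T^d)}\mathscr D_K(\mu,\nu)\le c\,L^{-\frac{s}{d-1}}.$$
   Context: $\mathbb T^d$ carries the flat metric and normalized Lebesgue measure. $H^s(\mathbb T^d)=\{f\in L^2:\sum_{k\in\mathbb Z^d}(1+4\pi^2|k|^2)^s|\hat f_k|^2<\infty\}$. $H_K$: reproducing kernel Hilbert space of $K$; $\mathscr D_K(\mu,\nu)=\sup_{\|\varphi\|_{H_K}\le1}|\int\varphi\,d(\mu-\nu)|$. $\mathrm{Lip}(\mathbb T^d)$: Lipschitz $\gamma\colon[0,1]\to\mathbb T^d$ with $\gamma(0)=\gamma(1)$, $L(\gamma)$ optimal Lipschitz constant; $\lambda$ Lebesgue measure on $[0,1]$; $\gamma_*$ pushforward. $\mathcal P^{\mathrm{Acurve}}_L=\{\gamma_*(\rho'\lambda):\gamma\in\mathrm{Lip},L(\gamma)\le L,\rho'\ge0,\int_0^1\rho'=1,L(\rho')\le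 L\}$; $\mathcal P^{\mathrm{Lcurve}}_L=\{\gamma_*\lambda:\gamma\in\mathrm{Lip},L(\gamma)\le L\}$. *)

(* Defs.v *)
From HB Require Import structures.
From mathcomp Require Import all_boot all_order all_algebra.
From mathcomp Require Import all_classical all_reals all_analysis.
Set Implicit Arguments. Unset Strict Implicit. Unset Printing Implicit Defensive.
Import Order.TTheory GRing.Theory Num.Theory.
Import numFieldNormedType.Exports.
Local Open Scope classical_set_scope.
Local Open Scope ring_scope.

(* The torus T^d = R^d / Z^d.  A point of T^d is represented by any
   representative in R^d = d.-tuple R; functions on T^d are Z^d-torus_periodic
   functions on R^d. *)

Section Torus.
Variable R : realType.
Variable d : nat.

Definition tshift (x : d.-tuple R) (k : d.-tuple int) : d.-tuple R :=
  [tuple tnth x i + (tnth k i)%:~R | i < d].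

Definition torus_periodic (f : d.-tuple R -> R) : Prop :=
  forall x k, f (tshift x k) = f x.

Definition distZ (a : R) : R :=
  Num.min (a - (Num.floor a)%:~R) ((Num.floor a)%:~R + 1 - a).

(* flat (quotient) metric of T^d: min_{k in Z^d} |x - y - k| *)
Definition tdist (x y : d.-tuple R) : R :=
  Num.sqrt (\sum_(i < d) (distZ (tnth x i - tnth y i)) ^+ 2).

Definition tcontinuous (f : d.-tuple R -> R) : Prop :=
  forall x (e : R), 0 < e -> exists2 del : R, 0 < del &
    forall y, tdist x y < del -> `|f x - f y| < e.

Definition kcontinuous (K : d.-tuple R -> d.-tuple R -> R) : Prop :=
  forall x y (e : R), 0 < e -> exists2 del : R, 0 < del &
    forall x' y', tdist x x' < del -> tdist y y' < del ->
      `|K x y - K x' y'| < e.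

End Torus.

(* Integral over T^d w.r.t. normalized Lebesgue measure, computed as the
   iterated Lebesgue integral over the fundamental domain [0,1]^d. *)
Fixpoint tint (R : realType) (n : nat) : (n.-tuple R -> \bar R) -> \bar R :=
  match n return (n.-tuple R -> \bar R) -> \bar R with
  | 0 => fun f => f [tuple]
  | n'.+1 => fun f =>
      (\int[@lebesgue_measure R]_(t in `[0%R, 1%R]) tint (fun x => f (cons_tuple t x)))%E
  end.

Section Sobolev.
Variable R : realType.
Variable d : nat.

Definition kdot (k : d.-tuple int) (x : d.-tuple R) : R :=
  \sum_(i < d) (tnth k i)%:~R * tnth x i.

Definition knorm2 (k : d.-tuple int) : R :=
  \sum_(i < d) ((tnth k i)%:~R : R) ^+ 2.

(* real and imaginary parts of the Fourier coefficient \hat f_k *)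
Definition fcos (f : d.-tuple R -> R) (k : d.-tuple int) : \bar R :=
  tint (fun x => (f x * cos (2 * pi * kdot k x))%:E).
Definition fsin (f : d.-tuple R -> R) (k : d.-tuple int) : \bar R :=
  tint (fun x => (f x * sin (2 * pi * kdot k x))%:E).

Definition fhat2 (f : d.-tuple R -> R) (k : d.-tuple int) : \bar R :=
  (fcos f k * fcos f k + fsin f k * fsin f k)%E.

Definition hs_norm2 (s : R) (f : d.-tuple R -> R) : \bar R :=
  (\esum_(k in [set: d.-tuple int])
     ((1 + 4 * pi ^+ 2 * knorm2 k) `^ s)%:E * fhat2 f k)%E.

Definition in_Hs (s : R) (f : d.-tuple R -> R) : Prop :=
  [/\ torus_periodic f, measurable_fun [set: d.-tuple R] f,
      (tint (fun x => (f x ^+ 2)%:E) < +oo)%E & (hs_norm2 s f < +oo)%E].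

Definition hs_norm (s : R) (f : d.-tuple R -> R) : R :=
  Num.sqrt (fine (hs_norm2 s f)).

End Sobolev.

Section RKHS.
Variable R : realType.
Variable d : nat.
Variable K : d.-tuple R -> d.-tuple R -> R.

Definition symmetric_kernel : Prop := forall x y, K x y = K y x.

Definition periodic_kernel : Prop :=
  forall x y k, K (tshift x k) y = K x y /\ K x (tshift y k) = K x y.

Definition posdef_kernel : Prop :=
  forall n (x : 'I_n -> d.-tuple R) (a : 'I_n -> R),
    0 <= \sum_(i < n) \sum_(j < n) a i * a j * K (x i) (x j).

(* |sum a_i f(x_i)| <= C || sum a_i K(x_i, .) ||_{H_K} for all finite
   combinations *)
Definition kbound (f : d.-tuple R -> R) (C : R) : Prop :=
  forall n (x : 'I_n -> d.-tuple R) (a : 'I_n -> R),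
    (\sum_(i < n) a i * f (x i)) ^+ 2
      <= C ^+ 2 * \sum_(i < n) \sum_(j < n) a i * a j * K (x i) (x j).

(* RKHS norm ||f||_{H_K} (= +oo iff f is not in H_K) *)
Definition Knorm (f : d.-tuple R -> R) : \bar R :=
  ereal_inf [set C%:E | C in [set C : R | 0 <= C /\ kbound f C]].

(* kernel discrepancy between two measures, given through their
   integration functionals phi |-> int phi dmu *)
Definition discK (I1 I2 : (d.-tuple R -> R) -> \bar R) : \bar R :=
  ereal_sup [set `|(I1 phi - I2 phi)%E|%E | phi in
               [set phi | (Knorm phi <= 1)%E]].

End RKHS.

Section Curves.
Variable R : realType.
Variable d : nat.

Definition lip_closed_curve (L : R) (g : R -> d.-tuple R) : Prop :=
  tdist (g 0) (g 1) = 0 /\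
  forall t t', t \in `[0, 1] -> t' \in `[0, 1] ->
    tdist (g t) (g t') <= L * `|t - t'|.

Definition lip_weight (L : R) (r : R -> R) : Prop :=
  [/\ forall t, t \in `[0, 1] -> 0 <= r t,
      (\int[@lebesgue_measure R]_(t in `[0%R, 1%R]) (r t)%:E = 1)%E &
      forall t t', t \in `[0, 1] -> t' \in `[0, 1] ->
        `|r t - r t'| <= L * `|t - t'|].

(* integration functional of gamma_*(rho' lambda) *)
Definition curve_int (g : R -> d.-tuple R) (r : R -> R)
  (phi : d.-tuple R -> R) : \bar R :=
  (\int[@lebesgue_measure R]_(t in `[0%R, 1%R]) (phi (g t) * r t)%:E)%E.

Definition dens_int (rho : d.-tuple R -> R) (phi : d.-tuple R -> R) : \bar R :=
  tint (fun x => (phi x * rho x)%:E).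

End Curves.

(* Main.v *)
Require Import Defs.
From HB Require Import structures.
From mathcomp Require Import all_boot all_order all_algebra.
From mathcomp Require Import all_classical all_reals all_analysis.
From mathcomp Require Import ring lra zify.
Set Implicit Arguments. Unset Strict Implicit. Unset Printing Implicit Defensive.
Import Order.TTheory GRing.Theory Num.Theory.
Import numFieldNormedType.Exports.
Local Open Scope classical_set_scope.
Local Open Scope ring_scope.

(* For N = (1, q, ..., q^(d-1)) the closed line t |-> t N has length O(q^(d-1)) and
   integrates exactly every character e^(2 pi i k.x), except for those with k <> 0 in the
   lattice N^perp; two distinct points of this lattice differ by at least q in some
   coordinate. Since phi and rho lie in H^s with s > d/2, the product of their Fourier
   series, Peetre's inequality and Cauchy-Schwarz bound the error of the line on phi * rho
   by O(q^(-s)). Reparametrizing the line with speed inversely proportional to rho turns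
   the weight rho into the constant weight, at the cost of a factor (max rho / min rho) in
   the Lipschitz constant; taking q of order L^(1/(d-1)) gives the rate. Fejer means replace
   the Fourier series by trigonometric polynomials. Minimizers exist because the admissible
   curves and weights form a compact subset of a product of intervals (Tychonoff), on which
   every functional (g, r) |-> int phi(g) r is continuous by equicontinuity. *)

(** Since mu has density rho, the line must integrate products phi * rho, with phi known only
    through its H^s bound. Inserting Fourier series directly would require controlling the
    coefficients of a product, a convolution of two infinite series. For trigonometric polynomials
    the product is a finite double sum, and the error on a product of two characters is read off at
    the frequencies k + l and k - l. The resulting bound does not depend on the degrees of the Fejer
    means, so their uniform convergence suffices to carry it over to phi and rho. The rate q^(-s) is
    the square root, left by Cauchy-Schwarz, of the sum of (1 + |k|^2)^(-s) over nonzero k in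
    N^perp. This sum has order q^(-2s), because after division by q the lattice points lie in
    distinct unit cells. The condition s > d/2 enters there and in the l^1 bound on Fourier
    coefficients. One existence result yields both minima: the weights have a Lipschitz constant l
    of their own, and l = 0 forces the weight 1. The discrepancy is a supremum of continuous
    functionals, so minimality of a limit point is checked for one phi at a time. *)

Section UnitInterval.
Variable R : realType.
Implicit Types (f g : R -> R).

Definition int01 f : R := \int[@lebesgue_measure R]_(t in `[0, 1]) f t.

Lemma integrable01 f : {within `[(0 : R), 1], continuous f} ->
  (@lebesgue_measure R).-integrable `[0, 1] (EFin \o f).
Proof. by apply: continuous_compact_integrable; exact: segment_compact. Qed.

Lemma int01E f : {within `[(0 : R), 1], continuous f} ->
  (\int[@lebesgue_measure R]_(t in `[0%R, 1%R]) (f t)%:E = (int01 f)%:E)%E.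
Proof.
move=> cf; rewrite /int01 /Rintegral fineK//.
by apply: integrable_fin_num => //; exact: integrable01.
Qed.

Lemma eq_int01 f g : {in `[0, 1], f =1 g} -> int01 f = int01 g.
Proof. by move=> fg; apply: eq_Rintegral => x; rewrite inE => /fg. Qed.

Lemma int01_cst (c : R) : int01 (fun=> c) = c.
Proof.
rewrite /int01 Rintegral_cst// -[RHS]mulr1; congr (_ * _).
have /= -> := @lebesgue_measure_itv R `[0, 1].
by rewrite lte_fin ltr01 oppr0 adde0.
Qed.

Lemma within_cst (A : set R) (c : R) : {within A, continuous (fun=> c)}.
Proof. by move=> x; exact: cvg_cst. Qed.

Lemma within_add (A : set R) f g : {within A, continuous f} ->
  {within A, continuous g} -> {within A, continuous (fun t => f t + g t)}.
Proof. by move=> cf cg x; apply: cvgD; [exact: cf|exact: cg]. Qed.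

Lemma within_mul (A : set R) f g : {within A, continuous f} ->
  {within A, continuous g} -> {within A, continuous (fun t => f t * g t)}.
Proof. by move=> cf cg x; apply: cvgM; [exact: cf|exact: cg]. Qed.

Lemma within_lin (A : set R) f g (a b : R) : {within A, continuous f} ->
  {within A, continuous g} -> {within A, continuous (fun t => a * f t + b * g t)}.
Proof.
by move=> cf cg; apply: within_add; apply: within_mul => //; exact: within_cst.
Qed.

Lemma int01_lin f g (a b : R) : {within `[(0 : R), 1], continuous f} ->
  {within `[(0 : R), 1], continuous g} ->
  int01 (fun t => a * f t + b * g t) = a * int01 f + b * int01 g.
Proof.
move=> cf cg; rewrite /int01 RintegralD//; last 2 first.
- by apply: integrable01; apply: within_mul => //; exact: within_cst.
- by apply: integrable01; apply: within_mul => //; exact: within_cst.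
by rewrite !RintegralZl//; exact: integrable01.
Qed.

Lemma le_int01 f g : {within `[(0 : R), 1], continuous f} ->
  {within `[(0 : R), 1], continuous g} ->
  (forall t, t \in `[0, 1] -> f t <= g t) -> int01 f <= int01 g.
Proof. by move=> cf cg fg; apply: le_Rintegral => //; exact: integrable01. Qed.

Lemma int01_dist f g (e : R) : {within `[(0 : R), 1], continuous f} ->
  {within `[(0 : R), 1], continuous g} ->
  (forall t, t \in `[0, 1] -> `|f t - g t| <= e) -> `|int01 f - int01 g| <= e.
Proof.
move=> cf cg fg.
have cE := @within_cst `[(0 : R), 1] e.
rewrite ler_distl -(int01_cst e) -[int01 g]mul1r; apply/andP; split.
  rewrite -[X in _ - X]mul1r -mulNr -int01_lin//; apply: le_int01 => //.
    exact: within_lin.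
  by move=> t /fg; rewrite ler_distl => /andP[+ _]; rewrite mul1r mulN1r.
rewrite -[X in _ + X]mul1r -int01_lin//; apply: le_int01 => //.
  exact: within_lin.
by move=> t /fg; rewrite ler_distl => /andP[_]; rewrite !mul1r.
Qed.

Lemma continuous_cosl (c : R) : continuous (fun t : R => cos (c * t)).
Proof.
move=> t; apply: (@continuous_comp _ _ _ (fun t => c * t) cos).
  exact: mulrl_continuous.
exact: continuous_cos.
Qed.

Lemma continuous_sinl (c : R) : continuous (fun t : R => sin (c * t)).
Proof.
move=> t; apply: (@continuous_comp _ _ _ (fun t => c * t) sin).
  exact: mulrl_continuous.
exact: continuous_sin.
Qed.

Lemma cos2piz (j : int) (x : R) : cos (x + 2 * pi * j%:~R) = cos x.
Proof.
have aux (n : nat) y : cos (y + 2 * pi * n%:R) = cos y :> R.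
  by rewrite mulr_natr [2 * pi]mulr_natl (periodicn (@cosD2pi R)).
case: (intP j) => [|n|n]; first by rewrite mulr0 addr0.
  exact: aux.
by rewrite -(aux n.+1) -addrA rmorphN/= mulrN addNr addr0.
Qed.

Lemma sin2piz (j : int) (x : R) : sin (x + 2 * pi * j%:~R) = sin x.
Proof. by rewrite -!cosBpihalf addrAC cos2piz. Qed.

Lemma int01_trig (j : int) :
  int01 (fun t => cos (2 * pi * j%:~R * t)) = (j == 0)%:R /\
  int01 (fun t => sin (2 * pi * j%:~R * t)) = 0.
Proof.
have [->|j0] := eqVneq j 0.
  split.
    by under [X in int01 X]eq_fun do rewrite mulr0 mul0r cos0; exact: int01_cst.
  by under [X in int01 X]eq_fun do rewrite mulr0 mul0r sin0; exact: int01_cst.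
set c : R := 2 * pi * j%:~R.
have c0 : c != 0 by rewrite !mulf_neq0 ?pnatr_eq0 ?intr_eq0// gt_eqF ?pi_gt0.
have dS (x : R) : is_derive x 1 (fun t => c^-1 * sin (c * t)) (cos (c * x)).
  by apply: is_derive_eq; rewrite /GRing.scale/=; field.
have dC (x : R) : is_derive x 1 (fun t => - c^-1 * cos (c * t)) (sin (c * x)).
  by apply: is_derive_eq; rewrite /GRing.scale/=; field.
have FTC (f F : R -> R) : continuous f -> (forall x : R, is_derive x (1 : R) F (f x)) ->
    int01 f = F 1 - F 0.
  move=> cf dF.
  have cF : continuous F.
    move=> x; apply/differentiable_continuous/derivable1_diffP.
    exact: (@ex_derive _ _ _ _ _ _ _ (dF x)).
  rewrite /int01 /Rintegral (@continuous_FTC2 _ f F)//.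
  - exact: continuous_subspaceT.
  - split; first by move=> x _; exact: (@ex_derive _ _ _ _ _ _ _ (dF x)).
      exact/cvg_at_right_filter/cF.
    exact/cvg_at_left_filter/cF.
  - by move=> x _; rewrite derive1E; exact: (@derive_val _ _ _ _ _ _ _ (dF x)).
split.
  rewrite (FTC _ _ (@continuous_cosl c) dS) mulr1 mulr0 sin0 mulr0 subr0.
  by rewrite /c -[X in sin X]add0r sin2piz sin0 mulr0.
rewrite (FTC _ _ (@continuous_sinl c) dC) mulr1 mulr0 cos0.
by rewrite /c -[X in cos X]add0r cos2piz cos0 subrr.
Qed.

End UnitInterval.

(** * Iterated integrals of bounded uniformly continuous functions *)

Section IteratedIntegral.
Variable R : realType.

(* This class of functions is stable under slicing, which makes the iterated integral
   [tint] finite and linear on it. *)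
Definition buc n (f : n.-tuple R -> R) : Prop :=
  (exists B : R, forall x, `|f x| <= B) /\
  (forall e : R, 0 < e -> exists2 del : R, 0 < del &
     forall x y, (forall i, `|tnth x i - tnth y i| < del) -> `|f x - f y| < e).

Lemma buc_cst n (c : R) : buc (fun _ : n.-tuple R => c).
Proof.
split; first by exists `|c|.
by move=> e e0; exists 1 => // x y _; rewrite subrr normr0.
Qed.

Lemma buc_add n (f g : n.-tuple R -> R) :
  buc f -> buc g -> buc (fun x => f x + g x).
Proof.
move=> [[B fB] uf] [[C gC] ug]; split.
  by exists (B + C) => x; rewrite (le_trans (ler_normD _ _))// lerD.
move=> e e0; have e2 : 0 < e / 2 by rewrite divr_gt0.
have [d1 d10 h1] := uf _ e2; have [d2 d20 h2] := ug _ e2.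
exists (Num.min d1 d2); first by rewrite lt_min d10.
move=> x y xy; rewrite opprD addrACA (le_lt_trans (ler_normD _ _))// [e]splitr.
by rewrite ltrD// ?h1 ?h2// => i; have := xy i; rewrite lt_min => /andP[].
Qed.

Lemma buc_mul n (f g : n.-tuple R -> R) :
  buc f -> buc g -> buc (fun x => f x * g x).
Proof.
move=> [[B fB] uf] [[C gC] ug]; split.
  by exists (B * C) => x; rewrite normrM ler_pM.
have B0 : 0 <= B by apply: le_trans (fB [tuple 0 | i < n]).
have C0 : 0 <= C by apply: le_trans (gC [tuple 0 | i < n]).
move=> e e0.
have e1 : 0 < e / 2 / (C + 1) by rewrite !divr_gt0// ltr_wpDl.
have e2 : 0 < e / 2 / (B + 1) by rewrite !divr_gt0// ltr_wpDl.
have [d1 d10 h1] := uf _ e1; have [d2 d20 h2] := ug _ e2.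
exists (Num.min d1 d2); first by rewrite lt_min d10.
move=> x y xy.
have {}h1 : `|f x - f y| < e / 2 / (C + 1).
  by apply: h1 => i; have := xy i; rewrite lt_min => /andP[].
have {}h2 : `|g x - g y| < e / 2 / (B + 1).
  by apply: h2 => i; have := xy i; rewrite lt_min => /andP[].
have -> : f x * g x - f y * g y = f x * (g x - g y) + (f x - f y) * g y by ring.
rewrite (le_lt_trans (ler_normD _ _))// [e]splitr !normrM ltr_leD//.
  apply: (@le_lt_trans _ _ (B * (e / 2 / (B + 1)))).
    by rewrite ler_pM// ltW.
  rewrite mulrA ltr_pdivrMr ?ltr_wpDl// mulrC ltr_pM2l ?divr_gt0//.
  by rewrite ltrDl.
apply: (@le_trans _ _ (e / 2 / (C + 1) * C)).
  by rewrite ler_pM// ltW.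
by rewrite mulrAC ler_pdivrMr ?ltr_wpDl// ler_pM2l ?divr_gt0// lerDl.
Qed.

Lemma buc_lin n (f g : n.-tuple R -> R) (a b : R) :
  buc f -> buc g -> buc (fun x => a * f x + b * g x).
Proof.
by move=> bf bg; apply: buc_add; apply: buc_mul => //; exact: buc_cst.
Qed.

Lemma buc_sum n (I : Type) (r : seq I) (F : I -> n.-tuple R -> R) :
  (forall i, buc (F i)) -> buc (fun x => \sum_(i <- r) F i x).
Proof.
move=> bF; elim: r => [|i r IH].
  by under eq_fun do rewrite big_nil; exact: buc_cst.
by under eq_fun do rewrite big_cons; exact: buc_add.
Qed.

Lemma buc_cons n (f : n.+1.-tuple R -> R) (t : R) :
  buc f -> buc (fun x : n.-tuple R => f (cons_tuple t x)).
Proof.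
move=> [[B fB] uf]; split; first by exists B.
move=> e /uf[d d0 h]; exists d => // x y xy; apply: h => i.
by case: (unliftP ord0 i) => [j ->|->]; rewrite ?tnthS ?tnth0 ?subrr ?normr0.
Qed.

Fixpoint rint (n : nat) : (n.-tuple R -> R) -> R :=
  match n return (n.-tuple R -> R) -> R with
  | 0 => fun f => f [tuple]
  | n'.+1 => fun f => int01 (fun t => rint (fun x => f (cons_tuple t x)))
  end.

(** The four properties need a common induction: linearity and monotonicity in dimension n + 1
    integrate the slice integrals over [0, 1], hence require their continuity in [t], and this
    continuity follows from the other three properties of the slices ([step]). *)
Lemma rint_spec n :
  [/\ forall (f g : n.-tuple R -> R) (a b : R), buc f -> buc g ->
        rint (fun x => a * f x + b * g x) = a * rint f + b * rint g,
      forall (f g : n.-tuple R -> R), buc f -> buc g ->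
        (forall x, f x <= g x) -> rint f <= rint g,
      forall c : R, rint (fun _ : n.-tuple R => c) = c &
      forall f : n.+1.-tuple R -> R, buc f ->
        continuous (fun t => rint (fun x : n.-tuple R => f (cons_tuple t x)))].
Proof.
have step (m : nat) :
  (forall (f g : m.-tuple R -> R) (a b : R), buc f -> buc g ->
        rint (fun x => a * f x + b * g x) = a * rint f + b * rint g) ->
  (forall (f g : m.-tuple R -> R), buc f -> buc g ->
        (forall x, f x <= g x) -> rint f <= rint g) ->
  (forall c : R, rint (fun _ : m.-tuple R => c) = c) ->
  forall f : m.+1.-tuple R -> R, buc f ->
        continuous (fun t => rint (fun x : m.-tuple R => f (cons_tuple t x))).
  move=> lin mon cst f bf t; apply/cvgrPdist_lt => e e0.
  have e2 : 0 < e / 2 by rewrite divr_gt0.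
  have [d d0 h] := bf.2 _ e2.
  near=> u.
  have tu (x : m.-tuple R) :
      `|f (cons_tuple t x) - f (cons_tuple u x)| < e / 2.
    apply: h => i; case: (unliftP ord0 i) => [j ->|->].
      by rewrite !tnthS subrr normr0.
    rewrite !tnth0; near: u; exact: (@cvgr_dist_lt _ _ _ _ _ id t).
  rewrite (@le_lt_trans _ _ (e / 2))// ?ltr_pdivrMr ?ltr_pMr ?ltr1n//.
  have ct := buc_cons t bf; have cu := buc_cons u bf.
  have K v w : buc (fun x : m.-tuple R => f (cons_tuple v x)) ->
      buc (fun x : m.-tuple R => f (cons_tuple w x)) ->
      (forall x : m.-tuple R,
        `|f (cons_tuple v x) - f (cons_tuple w x)| < e / 2) ->
      rint (fun x : m.-tuple R => f (cons_tuple v x)) <=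
      rint (fun x : m.-tuple R => f (cons_tuple w x)) + e / 2.
    move=> cv cw bessel_half; rewrite -[X in _ + X](cst (e / 2)).
    rewrite -[X in X + _]mul1r -[X in _ + X]mul1r -lin//; last exact: buc_cst.
    apply: mon => //; first by apply: buc_lin => //; exact: buc_cst.
    by move=> x; have := bessel_half x; rewrite ltr_distl => /andP[_ /ltW]; rewrite !mul1r.
  rewrite ler_distl; apply/andP; split; last exact: K.
  by rewrite lerBlDr; apply: K => // x; rewrite distrC.
elim: n => [|n [lin mon cst cont]].
  have [a b c] : [/\ forall (f g : 0.-tuple R -> R) (a b : R), buc f -> buc g ->
        rint (fun x => a * f x + b * g x) = a * rint f + b * rint g,
      forall (f g : 0.-tuple R -> R), buc f -> buc g ->
        (forall x, f x <= g x) -> rint f <= rint g &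
      forall c : R, rint (fun _ : 0.-tuple R => c) = c] by split => //=.
  by split => //; exact: step.
have cw f : buc f -> {within `[(0 : R), 1],
    continuous (fun t => rint (fun x : n.-tuple R => f (cons_tuple t x)))}.
  by move=> bf; apply: continuous_subspaceT; exact: cont.
have [a b c] : [/\ forall (f g : n.+1.-tuple R -> R) (a b : R), buc f -> buc g ->
        rint (fun x => a * f x + b * g x) = a * rint f + b * rint g,
      forall (f g : n.+1.-tuple R -> R), buc f -> buc g ->
        (forall x, f x <= g x) -> rint f <= rint g &
      forall c : R, rint (fun _ : n.+1.-tuple R => c) = c].
  split=> /= [f g a b bf bg|f g bf bg fg|c].
  - rewrite -int01_lin; [|exact: cw|exact: cw].
    by apply: eq_int01 => t _; rewrite lin//; exact: buc_cons.
  - apply: le_int01; [exact: cw|exact: cw|].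
    by move=> t _; apply: mon => //; exact: buc_cons.
  - by under eq_fun do rewrite cst; exact: int01_cst.
by split => //; exact: step.
Unshelve. all: by end_near. Qed.

Section Props.
Variable n : nat.
Implicit Types f g : n.-tuple R -> R.

Lemma rint_lin f g (a b : R) : buc f -> buc g ->
  rint (fun x => a * f x + b * g x) = a * rint f + b * rint g.
Proof. by case: (rint_spec n) => + _ _ _; exact. Qed.

Lemma le_rint f g : buc f -> buc g -> (forall x, f x <= g x) -> rint f <= rint g.
Proof. by case: (rint_spec n) => _ + _ _; exact. Qed.

Lemma rint_cst (c : R) : rint (fun _ : n.-tuple R => c) = c.
Proof. by case: (rint_spec n) => _ _ + _; exact. Qed.

Lemma rintD f g : buc f -> buc g -> rint (fun x => f x + g x) = rint f + rint g.
Proof.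
move=> bf bg; have := rint_lin 1 1 bf bg; rewrite !mul1r => <-.
by congr rint; apply/funext => x; rewrite !mul1r.
Qed.

Lemma rintZ f (a : R) : buc f -> rint (fun x => a * f x) = a * rint f.
Proof.
move=> bf; have := rint_lin a 0 bf bf; rewrite mul0r addr0 => <-.
by congr rint; apply/funext => x; rewrite mul0r addr0.
Qed.

Lemma rint_sum (I : Type) (r : seq I) (F : I -> n.-tuple R -> R) :
  (forall i, buc (F i)) ->
  rint (fun x => \sum_(i <- r) F i x) = \sum_(i <- r) rint (F i).
Proof.
move=> bF; elim: r => [|i r IH].
  by rewrite big_nil -[RHS]rint_cst; congr rint; apply/funext => x; rewrite big_nil.
rewrite big_cons -IH -rintD//; last exact: buc_sum.
by congr rint; apply/funext => x; rewrite big_cons.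
Qed.

Lemma rint_dist f g (e : R) : buc f -> buc g ->
  (forall x, `|f x - g x| <= e) -> `|rint f - rint g| <= e.
Proof.
move=> bf bg fg.
rewrite ler_distl -(rint_cst e) -[rint g]mul1r -mulN1r; apply/andP; split.
  rewrite -rint_lin//; last exact: buc_cst.
  apply: le_rint => //; first by apply: buc_lin => //; exact: buc_cst.
  by move=> x; have := fg x; rewrite ler_distl => /andP[+ _]; rewrite mul1r mulN1r.
rewrite -[X in _ + X]mul1r -rint_lin//; last exact: buc_cst.
apply: le_rint => //; first by apply: buc_lin => //; exact: buc_cst.
by move=> x; have := fg x; rewrite ler_distl => /andP[_]; rewrite !mul1r.
Qed.

End Props.

Lemma tint_rint n (f : n.-tuple R -> R) :
  buc f -> tint (fun x => (f x)%:E) = (rint f)%:E.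
Proof.
elim: n f => [//|n IH] f bf /=.
under eq_integral do rewrite (IH (fun x => f (cons_tuple _ x)) (buc_cons _ bf)).
apply: int01E; apply: continuous_subspaceT.
by case: (rint_spec n) => _ _ _; exact.
Qed.

Lemma kdot_cons n (a : int) (k : n.-tuple int) (t : R) (x : n.-tuple R) :
  kdot (cons_tuple a k) (cons_tuple t x) = a%:~R * t + kdot k x.
Proof.
rewrite /kdot big_ord_recl !tnth0; congr (_ + _).
by apply: eq_bigr => i _; rewrite !tnthS.
Qed.

(** A single [C] bounds both [F] and its slope; for cos (2 pi u) and sin (2 pi u) it is 2 pi, which
    exceeds 1. *)
Lemma buc_kdot n (k : n.-tuple int) (F : R -> R) (C : R) :
  (forall u, `|F u| <= C) -> (forall u v, `|F u - F v| <= C * `|u - v|) ->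
  buc (fun x => F (kdot k x)).
Proof.
move=> FB FL; split; first by exists C.
move=> e e0.
have C0 : 0 <= C by apply: le_trans (FB 0).
pose S : R := \sum_(i < n) `|(tnth k i)%:~R|.
have S0 : 0 <= S by rewrite sumr_ge0.
have D0 : 0 < C * S + 1 by rewrite ltr_wpDl// mulr_ge0.
exists (e / (C * S + 1)); first by rewrite divr_gt0.
move=> x y xy; apply: le_lt_trans (FL _ _) _.
have : `|kdot k x - kdot k y| <= S * (e / (C * S + 1)).
  rewrite /kdot -sumrB (le_trans (ler_norm_sum _ _ _))// mulr_suml.
  by apply: ler_sum => i _; rewrite -mulrBr normrM ler_wpM2l// ltW.
move=> /(ler_wpM2l C0) /le_lt_trans; apply.
rewrite !mulrA ltr_pdivrMr// [ltLHS]mulrC ltr_pM2l//.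
by rewrite ltrDl.
Qed.

End IteratedIntegral.

(** * Torus distance and trigonometric integrals *)

Section DistZ.
Variable R : realType.
Implicit Types a b : R.

Lemma distZD_int a (z : int) : distZ (a + z%:~R) = distZ a.
Proof.
by rewrite /distZ floorDrz ?intr_int// intrKfloor rmorphD/=; congr Num.min; ring.
Qed.

Lemma distZ_le_norm a : distZ a <= `|a|.
Proof.
have h1 := floor_le a; have h2 := floorD1_gt a.
rewrite /distZ ge_min; have [a0|a0] := leP 0 a.
  apply/orP; left; rewrite ger0_norm// lerBlDr lerDl.
  by rewrite ler0z floor_ge0.
apply/orP; right; rewrite ltr0_norm//.
have : (Num.floor a)%:~R + 1 <= 0 :> R.
  by rewrite -[1]/(1%:~R) -rmorphD/= -[0]/(0%:~R) ler_int lezD1 floor_lt0.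
lra.
Qed.

Lemma distZ_nearest a : exists z : int, distZ a = `|a - z%:~R|.
Proof.
have h1 := floor_le a; have h2 := floorD1_gt a.
rewrite /distZ /Num.min; case: ifP => _.
  by exists (Num.floor a); rewrite ger0_norm ?subr_ge0.
exists (Num.floor a + 1); rewrite rmorphD/= distrC ger0_norm// subr_ge0.
by move: h2; rewrite rmorphD/= => /ltW.
Qed.

Lemma distZ_ge0 a : 0 <= distZ a.
Proof. by have [z ->] := distZ_nearest a. Qed.

Lemma distZ0 : distZ (0 : R) = 0.
Proof.
apply/eqP; rewrite eq_le distZ_ge0 andbT.
by rewrite (le_trans (distZ_le_norm _))// normr0.
Qed.

Lemma distZ_lip a b : distZ a <= distZ b + `|a - b|.
Proof.
have [z ->] := distZ_nearest b.
rewrite -(distZD_int a (- z)) rmorphN/= (le_trans (distZ_le_norm _))//.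
rewrite (_ : a - z%:~R = (b - z%:~R) + (a - b)); last by ring.
exact: ler_normD.
Qed.

Lemma distZN a : distZ (- a) = distZ a.
Proof.
suff h b : distZ (- b) <= distZ b.
  by apply/eqP; rewrite eq_le h -{1}[a]opprK h.
have [z ->] := distZ_nearest b.
rewrite -(distZD_int _ z) (le_trans (distZ_le_norm _))//.
by rewrite addrC distrC.
Qed.

Lemma distZ_half a : distZ a <= 1 / 2.
Proof.
rewrite /distZ ge_min; have h1 := floor_le a; have h2 := floorD1_gt a.
have [h|h] := leP (a - (Num.floor a)%:~R) (1 / 2); first by [].
by apply/orP; right; move: h; lra.
Qed.

Lemma cos_distZ a : cos (2 * pi * distZ a) = cos (2 * pi * a).
Proof.
have [z ->] := distZ_nearest a.
have -> : 2 * pi * a = 2 * pi * (a - z%:~R) + 2 * pi * z%:~R by ring.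
by rewrite cos2piz -[in LHS]cos_norm -[in RHS]cos_norm !normrM normr_id.
Qed.

Lemma le_cos_distZ a (del : R) : 0 <= del -> del <= distZ a ->
  cos (2 * pi * a) <= cos (2 * pi * del).
Proof.
move=> d0 da; rewrite -cos_distZ.
have p0 := @pi_gt0 R; have h := distZ_half a; have g0 := distZ_ge0 a.
rewrite leNgt ltr_cos ?in_itv/=.
- by rewrite -leNgt ler_pM2l// mulr_gt0.
- by apply/andP; split; nra.
- by apply/andP; split; nra.
Qed.

Lemma cos_lt1_small (del : R) : 0 < del -> del <= 1 / 2 -> cos (2 * pi * del) < 1.
Proof.
move=> d0 d1; have p0 := @pi_gt0 R.
have h0 : 0 < 2 * pi * del by rewrite !mulr_gt0.
have h1 : 2 * pi * del <= pi by nra.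
have i0 : 0 \in `[0, pi : R] by rewrite in_itv/= lexx ltW.
have i1 : 2 * pi * del \in `[0, pi : R] by rewrite in_itv/= h1 ltW.
by have := ltr_cos i0 i1; rewrite cos0 h0.
Qed.

Lemma lip_MVT (F dF : R -> R) (C : R) : (forall x : R, is_derive x (1 : R) F (dF x)) ->
  (forall x, `|dF x| <= C) -> forall u v, `|F u - F v| <= C * `|u - v|.
Proof.
move=> dFP FC u v.
have cF : continuous F.
  move=> x; apply/differentiable_continuous/derivable1_diffP.
  exact: (@ex_derive _ _ _ _ _ _ _ (dFP x)).
wlog uv : u v / u <= v.
  move=> h; have [|/ltW] := leP u v; first exact: h.
  by rewrite distrC [X in _ * X]distrC; exact: h.
have [c _] := @MVT_segment R F dF u v uv (fun x _ => dFP x) (continuous_subspaceT cF).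
rewrite distrC => ->; rewrite normrM [X in _ * X]distrC.
by rewrite ler_wpM2r.
Qed.

Lemma cos_lip a b : `|cos (2 * pi * a) - cos (2 * pi * b)| <= (2 * pi) * `|a - b| :> R.
Proof.
have := @lip_MVT cos (fun x => - sin x) 1 (@is_derive_cos R).
move=> /(_ _ (2 * pi * a) (2 * pi * b)) => H.
apply: le_trans (H _) _; first by move=> x; rewrite normrN sin_max.
rewrite mul1r -mulrBr normrM ger0_norm// mulr_ge0// ltW ?pi_gt0//.
Qed.

Lemma sin_lip a b : `|sin (2 * pi * a) - sin (2 * pi * b)| <= (2 * pi) * `|a - b| :> R.
Proof.
have := @lip_MVT sin cos 1 (@is_derive_sin R) (@cos_max R).
move=> /(_ (2 * pi * a) (2 * pi * b)) => H.
apply: le_trans H _.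
rewrite mul1r -mulrBr normrM ger0_norm// mulr_ge0// ltW ?pi_gt0//.
Qed.

Lemma le1_2pi : 1 <= 2 * pi :> R.
Proof. by have := @pi_ge2 R; lra. Qed.

End DistZ.

Section TorusTrig.
Variable R : realType.

Definition zero_freq n : n.-tuple int := [tuple 0 | i < n].

(** Used with [e] equal to 1 or -1: the two frequencies created by multiplying two characters. *)
Definition kcomb n (e : int) (k l : n.-tuple int) : n.-tuple int :=
  [tuple tnth k i + e * tnth l i | i < n].

Lemma kdot_comb n e (k l : n.-tuple int) (x : n.-tuple R) :
  kdot (kcomb e k l) x = kdot k x + e%:~R * kdot l x.
Proof.
rewrite /kdot mulr_sumr -big_split/=; apply: eq_bigr => i _.
by rewrite tnth_mktuple rmorphD rmorphM/= mulrDl mulrA.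
Qed.

Lemma buc_cosk n (k : n.-tuple int) : buc (fun x : n.-tuple R => cos (2 * pi * kdot k x)).
Proof.
apply: (@buc_kdot _ _ _ (fun u => cos (2 * pi * u)) (2 * pi)).
  by move=> u; rewrite (le_trans (cos_max _))// le1_2pi.
exact: cos_lip.
Qed.

Lemma buc_sink n (k : n.-tuple int) : buc (fun x : n.-tuple R => sin (2 * pi * kdot k x)).
Proof.
apply: (@buc_kdot _ _ _ (fun u => sin (2 * pi * u)) (2 * pi)).
  by move=> u; rewrite (le_trans (sin_max _))// le1_2pi.
exact: sin_lip.
Qed.

Lemma zero_freq_cons n : zero_freq n.+1 = cons_tuple 0 (zero_freq n).
Proof.
apply/eq_from_tnth => i; case: (unliftP ord0 i) => [j ->|->].
  by rewrite tnthS !tnth_mktuple.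
by rewrite tnth0 tnth_mktuple.
Qed.

Lemma cons_tuple_eq (T : eqType) n (a b : T) (k l : n.-tuple T) :
  (cons_tuple a k == cons_tuple b l) = (a == b) && (k == l).
Proof. by rewrite -!val_eqE/= eqseq_cons. Qed.

Lemma rint_trig n (k : n.-tuple int) :
  rint (fun x : n.-tuple R => cos (2 * pi * kdot k x)) = (k == zero_freq n)%:R /\
  rint (fun x : n.-tuple R => sin (2 * pi * kdot k x)) = 0.
Proof.
elim: n k => [|n IH] k.
  by rewrite /= /kdot !big_ord0 mulr0 cos0 sin0 tuple0 (tuple0 (zero_freq 0)) eqxx.
case/tupleP: k => a k; have [IHc IHs] := IH k; have [Ic Is] := @int01_trig R a.
have [bc bs] := (buc_cosk k, buc_sink k).
split=> /=.
  under eq_fun => t.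
    rewrite (_ : rint _ = cos (2 * pi * a%:~R * t) * (k == zero_freq n)%:R); first over.
    rewrite (_ : (fun x : n.-tuple R => _) = (fun x =>
       cos (2 * pi * a%:~R * t) * cos (2 * pi * kdot k x) +
       (- sin (2 * pi * a%:~R * t)) * sin (2 * pi * kdot k x))).
      by rewrite rint_lin// IHc IHs mulr0 addr0.
    by apply/funext => x; rewrite kdot_cons mulrDr cosD mulNr mulrA.
  rewrite (_ : (fun t => _) = (fun t => (k == zero_freq n)%:R * cos (2 * pi * a%:~R * t)
     + 0 * cos (2 * pi * a%:~R * t))); last first.
    by apply/funext => t; rewrite mul0r addr0 mulrC.
  rewrite int01_lin; try exact/continuous_subspaceT/continuous_cosl.
  rewrite mul0r addr0 Ic zero_freq_cons cons_tuple_eq.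
  by case: (a == 0); rewrite ?mulr1 ?mulr0.
under eq_fun => t.
  rewrite (_ : rint _ = sin (2 * pi * a%:~R * t) * (k == zero_freq n)%:R); first over.
  rewrite (_ : (fun x : n.-tuple R => _) = (fun x =>
     sin (2 * pi * a%:~R * t) * cos (2 * pi * kdot k x) +
     cos (2 * pi * a%:~R * t) * sin (2 * pi * kdot k x))).
    by rewrite rint_lin// IHc IHs mulr0 addr0.
  by apply/funext => x; rewrite kdot_cons mulrDr sinD mulrA.
rewrite (_ : (fun t => _) = (fun t => (k == zero_freq n)%:R * sin (2 * pi * a%:~R * t)
   + 0 * sin (2 * pi * a%:~R * t))); last first.
  by apply/funext => t; rewrite mul0r addr0 mulrC.
rewrite int01_lin; try exact/continuous_subspaceT/continuous_sinl.
by rewrite mul0r addr0 Is mulr0.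
Qed.

Definition zdot n (k N : n.-tuple int) : int := \sum_(i < n) tnth k i * tnth N i.

Definition line n (N : n.-tuple int) (t : R) : n.-tuple R :=
  [tuple (tnth N i)%:~R * t | i < n].

Lemma kdot_line n (k N : n.-tuple int) t : kdot k (line N t) = (zdot k N)%:~R * t.
Proof.
rewrite /kdot /zdot rmorph_sum/= mulr_suml; apply: eq_bigr => i _.
by rewrite tnth_mktuple rmorphM/= mulrA.
Qed.

Lemma line_trig n (k N : n.-tuple int) :
  int01 (fun t => cos (2 * pi * kdot k (line N t))) = (zdot k N == 0)%:R :> R /\
  int01 (fun t => sin (2 * pi * kdot k (line N t))) = 0 :> R.
Proof.
have [<- <-] := @int01_trig R (zdot k N).
by split; congr int01; apply/funext => t; rewrite kdot_line mulrA.
Qed.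

Lemma buc_line n (N : n.-tuple int) (f : n.-tuple R -> R) :
  buc f -> continuous (fun t => f (line N t)).
Proof.
move=> [_ uf] t; apply/cvgrPdist_lt => e /uf[d d0 h].
pose S : R := \sum_(i < n) `|(tnth N i)%:~R| + 1.
have S0 : 0 < S by rewrite ltr_wpDl// sumr_ge0.
near=> u; apply: h => i; rewrite !tnth_mktuple -mulrBr normrM.
apply: (@le_lt_trans _ _ (S * `|t - u|)).
  rewrite ler_wpM2r// /S (bigD1 i)//= -addrA lerDl.
  by rewrite addr_ge0// sumr_ge0.
rewrite mulrC -ltr_pdivlMr//; near: u.
by apply: (@cvgr_dist_lt _ _ _ _ _ id t) => //; rewrite divr_gt0.
Unshelve. all: by end_near. Qed.

Definition line_error n (N : n.-tuple int) (f : n.-tuple R -> R) : R :=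
  int01 (fun t => f (line N t)) - rint f.

(* The nonzero frequencies orthogonal to N are those not integrated exactly by the
   line; see [line_error_trig]. *)
Definition resonant n (N m : n.-tuple int) : R := ((zdot m N == 0) && (m != zero_freq n))%:R.

Lemma line_error_lin n (N : n.-tuple int) (f g : n.-tuple R -> R) (a b : R) :
  buc f -> buc g -> line_error N (fun x => a * f x + b * g x) = a * line_error N f + b * line_error N g.
Proof.
move=> bf bg; rewrite /line_error rint_lin// int01_lin; last 2 first.
- exact/continuous_subspaceT/buc_line.
- exact/continuous_subspaceT/buc_line.
by ring.
Qed.

Lemma lerrD n (N : n.-tuple int) (f g : n.-tuple R -> R) :
  buc f -> buc g -> line_error N (fun x => f x + g x) = line_error N f + line_error N g.
Proof.
move=> bf bg; have := line_error_lin N 1 1 bf bg; rewrite !mul1r => <-.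
by congr line_error; apply/funext => x; rewrite !mul1r.
Qed.

Lemma lerr0 n (N : n.-tuple int) : line_error N (fun=> 0) = 0.
Proof. by rewrite /line_error int01_cst rint_cst subrr. Qed.

Lemma line_error_sum n (N : n.-tuple int) (I : Type) (r : seq I) (F : I -> n.-tuple R -> R) :
  (forall i, buc (F i)) ->
  line_error N (fun x => \sum_(i <- r) F i x) = \sum_(i <- r) line_error N (F i).
Proof.
move=> bF; elim: r => [|i r IH].
  by rewrite big_nil -[RHS](lerr0 N); congr line_error; apply/funext => x; rewrite big_nil.
rewrite big_cons -IH -lerrD//; last exact: buc_sum.
by congr line_error; apply/funext => x; rewrite big_cons.
Qed.

Lemma line_error_dist n (N : n.-tuple int) (f g : n.-tuple R -> R) (e : R) :
  buc f -> buc g -> (forall x, `|f x - g x| <= e) ->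
  `|line_error N f - line_error N g| <= e + e.
Proof.
move=> bf bg fg; rewrite /line_error opprD addrACA (le_trans (ler_normD _ _))// lerD//.
  by apply: int01_dist => //; exact/continuous_subspaceT/buc_line.
by rewrite -opprD normrN; exact: rint_dist.
Qed.

Lemma line_error_trig n (N m : n.-tuple int) :
  line_error N (fun x => cos (2 * pi * kdot m x)) = resonant N m /\
  line_error N (fun x => sin (2 * pi * kdot m x)) = 0.
Proof.
rewrite /line_error /resonant.
have [-> ->] := line_trig m N; have [-> ->] := rint_trig m.
rewrite subrr; split => //; have [->|m0] := eqVneq m (zero_freq n); last first.
  by rewrite subr0 andbT.
rewrite andbF (_ : zdot _ _ = 0) ?eqxx ?subrr//.
by rewrite /zdot big1// => i _; rewrite tnth_mktuple mul0r.
Qed.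

End TorusTrig.

(** * Fejer means *)

Section Fejer.
Variable R : realType.

Definition rcos n (f : n.-tuple R -> R) (k : n.-tuple int) : R :=
  rint (fun y => f y * cos (2 * pi * kdot k y)).

Definition rsin n (f : n.-tuple R -> R) (k : n.-tuple int) : R :=
  rint (fun y => f y * sin (2 * pi * kdot k y)).

(** Measuring closeness by [distZ] builds Z^n-periodicity into the notion, and it suits the Fejer
    kernel, which sees x - y only modulo 1. *)
Definition torus_buc n (f : n.-tuple R -> R) : Prop :=
  (exists B : R, forall x, `|f x| <= B) /\
  (forall e : R, 0 < e -> exists2 del : R, 0 < del &
     forall x y, (forall i, distZ (tnth x i - tnth y i) < del) -> `|f x - f y| < e).

Lemma torus_buc_buc n (f : n.-tuple R -> R) : torus_buc f -> buc f.
Proof.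
move=> [fB uf]; split=> // e /uf[d d0 h]; exists d => // x y xy; apply: h => i.
exact: le_lt_trans (distZ_le_norm _) (xy i).
Qed.

Section Kernel.
Variables n M : nat.

Notation idx := {ffun 'I_n -> 'I_M.+1}.

Definition freq_diff (p : idx * idx) : n.-tuple int :=
  [tuple (p.1 i : nat)%:Z - (p.2 i : nat)%:Z | i < n].

Definition fejer_weight : R := (#|{: idx}|%:R)^-1.

(** The convolution of [f] with [fejer_kernel] (see [fejerE]), written through the Fourier
    coefficients of [f] because the H^s bound speaks of these only. A frequency is repeated once for
    each pair that represents it, which produces the usual triangular weights. *)
Definition fejer (f : n.-tuple R -> R) (x : n.-tuple R) : R :=
  \sum_(p : idx * idx) (fejer_weight * rcos f (freq_diff p) * cos (2 * pi * kdot (freq_diff p) x) +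
                        fejer_weight * rsin f (freq_diff p) * sin (2 * pi * kdot (freq_diff p) x)).

(* Summing over pairs p = (j, l) of frequencies in {0,..,M}^n, with character j - l,
   makes the kernel a sum of two squares, without any product structure. *)
Definition fejer_kernel (x y : n.-tuple R) : R :=
  \sum_(p : idx * idx) fejer_weight * cos (2 * pi * kdot (freq_diff p) x - 2 * pi * kdot (freq_diff p) y).

Lemma card_idx_gt0 : 0 < #|{: idx}|%:R :> R.
Proof. by rewrite ltr0n card_ffun !card_ord expn_gt0. Qed.

Lemma fejer_weight_gt0 : 0 < fejer_weight.
Proof. by rewrite invr_gt0 card_idx_gt0. Qed.

Lemma buc_cosB (k : n.-tuple int) (x : n.-tuple R) :
  buc (fun y => cos (2 * pi * kdot k x - 2 * pi * kdot k y)).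
Proof.
under eq_fun do rewrite cosB.
by apply: buc_lin; [exact: buc_cosk|exact: buc_sink].
Qed.

Lemma rint_cosB (k : n.-tuple int) (x : n.-tuple R) :
  rint (fun y => cos (2 * pi * kdot k x - 2 * pi * kdot k y)) = (k == zero_freq n)%:R.
Proof.
under eq_fun do rewrite cosB.
rewrite rint_lin; [|exact: buc_cosk|exact: buc_sink].
have [-> ->] := rint_trig R k; rewrite mulr0 addr0.
have [->|] := eqVneq k (zero_freq n); last by rewrite mulr0.
rewrite mulr1 /kdot big1 ?mulr0 ?cos0// => i _.
by rewrite tnth_mktuple mul0r.
Qed.

Lemma buc_fejer_kernel x : buc (fejer_kernel x).
Proof.
by apply: buc_sum => p; apply: buc_mul; [exact: buc_cst|exact: buc_cosB].
Qed.

Lemma fejerE f x : buc f -> fejer f x = rint (fun y => f y * fejer_kernel x y).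
Proof.
move=> bf; have bc k := buc_mul bf (buc_cosk R k); have bs k := buc_mul bf (buc_sink R k).
transitivity (rint (fun y => \sum_(p : idx * idx)
    ((fejer_weight * cos (2 * pi * kdot (freq_diff p) x)) * (f y * cos (2 * pi * kdot (freq_diff p) y)) +
     (fejer_weight * sin (2 * pi * kdot (freq_diff p) x)) * (f y * sin (2 * pi * kdot (freq_diff p) y))))).
  rewrite rint_sum; last by move=> p; exact: buc_lin.
  by apply: eq_bigr => p _; rewrite rint_lin//; congr (_ + _); rewrite mulrAC.
congr rint; apply/funext => y; rewrite mulr_sumr; apply: eq_bigr => p _.
by rewrite cosB; ring.
Qed.

Lemma fejer_kernel_ge0 x y : 0 <= fejer_kernel x y.
Proof.
pose th (j : idx) : R := 2 * pi * (\sum_(i < n) (j i)%:R * (tnth x i - tnth y i)).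
rewrite /fejer_kernel -mulr_sumr mulr_ge0// ?(ltW fejer_weight_gt0)//.
rewrite (_ : \sum_p _ = (\sum_j cos (th j)) ^+ 2 + (\sum_j sin (th j)) ^+ 2).
  by rewrite addr_ge0// sqr_ge0.
rewrite !expr2 !mulr_suml -big_split/=.
rewrite -(pair_bigA _ (fun j l => cos (2 * pi * kdot (freq_diff (j, l)) x -
  2 * pi * kdot (freq_diff (j, l)) y)))/=.
apply: eq_bigr => j _; rewrite !mulr_sumr -big_split/=; apply: eq_bigr => l _.
rewrite -cosB /th -!mulrBr /kdot -!sumrB; congr (cos (_ * _)).
by apply: eq_bigr => i _; rewrite tnth_mktuple rmorphB/=; ring.
Qed.

(** Only the diagonal pairs (j, j) have frequency zero, and [fejer_weight] is the inverse of their
    number. *)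
Lemma rint_fejer_kernel x : rint (fejer_kernel x) = 1.
Proof.
rewrite rint_sum; last first.
  by move=> p; apply: buc_mul; [exact: buc_cst|exact: buc_cosB].
rewrite (eq_bigr (fun p => fejer_weight * (freq_diff p == zero_freq n)%:R)); last first.
  by move=> p _; rewrite rintZ ?rint_cosB//; exact: buc_cosB.
rewrite -(pair_bigA _ (fun j l => fejer_weight * (freq_diff (j, l) == zero_freq n)%:R))/=.
rewrite (eq_bigr (fun=> fejer_weight)); last first.
  move=> j _; rewrite (bigD1 j)//= big1 ?addr0.
    have -> : freq_diff (j, j) = zero_freq n.
      by apply/eq_from_tnth => i; rewrite !tnth_mktuple subrr.
    by rewrite eqxx mulr1.
  move=> l lj; rewrite (_ : (_ == _) = false) ?mulr0//.
  apply: contraNF lj => /eqP E; apply/eqP/ffunP => i.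
  move/(congr1 (fun t => tnth t i)): E; rewrite !tnth_mktuple => /eqP.
  by rewrite subr_eq0 => /eqP[?]; apply/val_inj.
rewrite sumr_const -[LHS]mulr_natl; apply: mulfV.
by rewrite gt_eqF// card_idx_gt0.
Qed.

Definition unit_freq (i : 'I_n) : n.-tuple int := [tuple (j == i)%:Z | j < n].

Lemma kdot_unit_freq i (x : n.-tuple R) : kdot (unit_freq i) x = tnth x i.
Proof.
rewrite /kdot (bigD1 i)//= tnth_mktuple eqxx mul1r big1 ?addr0// => j ji.
by rewrite tnth_mktuple (negbTE ji) mul0r.
Qed.

Lemma sum_not_last (i : 'I_n) :
  \sum_(l : idx) (l i < M)%N%:R = (1 - M.+1%:R^-1) * #|{: idx}|%:R :> R.
Proof.
(* Writing the indicator as a product over coordinates lets the sum over all functions factor into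
   one-dimensional sums. *)
pose F (i' : 'I_n) (c : 'I_M.+1) : R := if i' == i then (c < M)%N%:R else 1.
transitivity (\sum_(l : idx) \prod_i' F i' (l i')).
  apply: eq_bigr => l _; rewrite (bigD1 i)//= /F eqxx big1 ?mulr1//.
  by move=> j /negbTE ->.
rewrite -bigA_distr_bigA (bigD1 i)//=.
have E : \sum_(c < M.+1) F i c = (1 - M.+1%:R^-1) * M.+1%:R.
  rewrite /F eqxx big_ord_recr/= ltnn addr0 mulrBl mul1r mulVf ?pnatr_eq0//.
  rewrite (eq_bigr (fun=> 1)) => [|c _]; last by rewrite ltn_ord.
  by rewrite sumr_const card_ord -natr1 addrK.
rewrite {}E -mulrA; apply: (congr1 (fun z : R => (1 - M.+1%:R^-1) * z)).
rewrite card_ffun !card_ord natrX -[in RHS](card_ord n) -prodr_const [in RHS](bigD1 i)//=.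
apply: (congr1 (fun z : R => M.+1%:R * z)); apply: eq_bigr => j ji.
by rewrite /F (negbTE ji) sumr_const card_ord.
Qed.

(** For l i = M the successor leaves the range and [inord] gives a default value; the definition is
    exploited only when l i < M. *)
Definition shift_shift_up (i : 'I_n) (l : idx) : idx :=
  [ffun j => if j == i then inord (l j).+1 else l j].

Lemma freq_diff_shift_up i (l : idx) : (l i < M)%N ->
  kcomb (-1) (freq_diff (shift_shift_up i l, l)) (unit_freq i) = zero_freq n /\
  kcomb 1 (freq_diff (l, shift_shift_up i l)) (unit_freq i) = zero_freq n.
Proof.
move=> li; split; apply/eq_from_tnth => j; rewrite !tnth_mktuple/= !ffunE;
  case: eqP => [->|_]; rewrite /= ?inordK//; lia.
Qed.

(** The cosine shifts every frequency by plus or minus the i-th unit vector, so the integral counts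
    pairs differing by one step in direction i. A fraction M / (M + 1) of the indices l admits such
    a step; all other terms are nonnegative and dropped. *)
Lemma rint_fejer_kernel_cos i (x : n.-tuple R) :
  1 - M.+1%:R^-1 <=
  rint (fun y => fejer_kernel x y * cos (2 * pi * (tnth x i - tnth y i))).
Proof.
have E y : fejer_kernel x y * cos (2 * pi * (tnth x i - tnth y i)) =
  \sum_(p : idx * idx) (fejer_weight / 2 *
     cos (2 * pi * kdot (kcomb 1 (freq_diff p) (unit_freq i)) x - 2 * pi * kdot (kcomb 1 (freq_diff p) (unit_freq i)) y)
   + fejer_weight / 2 * cos (2 * pi * kdot (kcomb (-1) (freq_diff p) (unit_freq i)) x
                   - 2 * pi * kdot (kcomb (-1) (freq_diff p) (unit_freq i)) y)).
  rewrite mulr_suml; apply: eq_bigr => p _; rewrite !kdot_comb !kdot_unit_freq.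
  set A := kdot _ x; set B := kdot _ y.
  have -> : 2 * pi * (A + 1%:~R * tnth x i) - 2 * pi * (B + 1%:~R * tnth y i) =
    (2 * pi * A - 2 * pi * B) + 2 * pi * (tnth x i - tnth y i) by ring.
  have -> : 2 * pi * (A + (-1)%:~R * tnth x i) - 2 * pi * (B + (-1)%:~R * tnth y i) =
    (2 * pi * A - 2 * pi * B) - 2 * pi * (tnth x i - tnth y i).
    by rewrite rmorphN/=; ring.
  move: (2 * pi * A - _) (2 * pi * (tnth x i - _)) => U V.
  by rewrite cosD cosB; field.
rewrite (funext E) rint_sum; last by move=> p; apply: buc_lin; exact: buc_cosB.
under eq_bigr do [rewrite rint_lin; [|exact: buc_cosB|exact: buc_cosB]; rewrite !rint_cosB].
rewrite big_split/=.
have H : 1 - M.+1%:R^-1 = 2 * (fejer_weight / 2 * \sum_(l : idx) (l i < M)%N%:R).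
  have := card_idx_gt0; rewrite sum_not_last /fejer_weight.
  move: (#|_|%:R) (M.+1%:R^-1) => c m c0; field.
  by rewrite gt_eqF.
rewrite H mulr_natl mulr2n lerD//.
  rewrite -(pair_bigA _ (fun j l => fejer_weight / 2 * (kcomb 1 (freq_diff (j, l)) (unit_freq i) == zero_freq n)%:R))/=.
  rewrite mulr_sumr; apply: ler_sum => l _; rewrite (bigD1 (shift_shift_up i l))//=.
  rewrite ler_wpDr ?sumr_ge0// => [*|]; first by rewrite mulr_ge0// divr_ge0// ltW ?fejer_weight_gt0.
  rewrite ler_wpM2l ?divr_ge0 ?(ltW fejer_weight_gt0)//.
  by case: ltnP => // /freq_diff_shift_up[_ ->]; rewrite eqxx.
rewrite -(pair_bigA _ (fun j l => fejer_weight / 2 * (kcomb (-1) (freq_diff (j, l)) (unit_freq i) == zero_freq n)%:R))/=.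
rewrite exchange_big/= mulr_sumr; apply: ler_sum => l _; rewrite (bigD1 (shift_shift_up i l))//=.
rewrite ler_wpDr ?sumr_ge0// => [*|]; first by rewrite mulr_ge0// divr_ge0// ltW ?fejer_weight_gt0.
rewrite ler_wpM2l ?divr_ge0 ?(ltW fejer_weight_gt0)//.
by case: ltnP => // /freq_diff_shift_up[-> _]; rewrite eqxx.
Qed.

(* Korovkin's argument: only the integrals of the kernel against 1 and against
   cos (2 pi (x_i - y_i)) matter. *)
Lemma fejer_dist f (e C : R) : buc f -> 0 <= C ->
  (forall x y, `|f y - f x| <=
     e + C * \sum_(i < n) (1 - cos (2 * pi * (tnth x i - tnth y i)))) ->
  forall x, `|fejer f x - f x| <= e + C * (n%:R / M.+1%:R).
Proof.
move=> bf C0 fC x; have bk := buc_fejer_kernel x.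
have bci i : buc (fun y : n.-tuple R => cos (2 * pi * (tnth x i - tnth y i))).
  have := buc_cosB (unit_freq i) x; congr buc; apply/funext => y.
  by rewrite !kdot_unit_freq mulrBr.
have bcst (c : R) := buc_cst n c.
pose G y := e + C * \sum_(i < n) (1 - cos (2 * pi * (tnth x i - tnth y i))).
have bG : buc G.
  apply: buc_add => //; apply: buc_mul => //; apply: buc_sum => i.
  apply: buc_add => //; rewrite [X in buc X](_ : _ = fun y => -1 * cos (2 * pi * (tnth x i - tnth y i))).
    exact: buc_mul.
  by apply/funext => y; rewrite mulN1r.
have bD : buc (fun y => f y - f x) by apply: buc_add.
have EG : rint (fun y => G y * fejer_kernel x y) <= e + C * (n%:R / M.+1%:R).
  rewrite (_ : (fun y => _) = fun y => e * fejer_kernel x y + C * \sum_(i < n)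
     (fejer_kernel x y + -1 * (fejer_kernel x y * cos (2 * pi * (tnth x i - tnth y i))))); last first.
    apply/funext => y; rewrite /G mulrDl -mulrA mulr_suml; congr (_ + _ * _).
    by apply: eq_bigr => i _; ring.
  have bi i : buc (fun y => fejer_kernel x y + -1 * (fejer_kernel x y * cos (2 * pi * (tnth x i - tnth y i)))).
    by apply: buc_add => //; apply: buc_mul => //; exact: buc_mul.
  rewrite rint_lin//; last exact: buc_sum.
  rewrite rint_fejer_kernel mulr1 lerD2l ler_wpM2l// rint_sum//.
  have -> : n%:R / M.+1%:R = \sum_(i < n) M.+1%:R^-1 :> R.
    by rewrite sumr_const card_ord [LHS]mulr_natl.
  apply: ler_sum => i _.
  rewrite rintD//; last by apply: buc_mul => //; exact: buc_mul.
  rewrite rint_fejer_kernel rintZ; last exact: buc_mul.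
  by rewrite mulN1r lerBlDr -lerBlDl; exact: rint_fejer_kernel_cos.
apply: le_trans EG; rewrite fejerE// -[X in _ - X]mulr1 -(rint_fejer_kernel x) -rintZ//.
rewrite -mulN1r -rintZ; last exact: buc_mul.
rewrite -rintD; [|exact: buc_mul|by apply: buc_mul => //; exact: buc_mul].
rewrite (_ : (fun y => _) = fun y => (f y - f x) * fejer_kernel x y); last first.
  by apply/funext => y; ring.
have bl : buc (fun y => (f y - f x) * fejer_kernel x y) by exact: buc_mul.
have br : buc (fun y => G y * fejer_kernel x y) by exact: buc_mul.
rewrite ler_norml; apply/andP; split.
  rewrite -mulN1r -rintZ//; apply: le_rint => //; first by exact: buc_mul.
  move=> y; rewrite mulN1r -mulNr ler_wpM2r ?fejer_kernel_ge0//.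
  by have := fC x y; rewrite ler_norml => /andP[].
apply: le_rint => // y; rewrite ler_wpM2r ?fejer_kernel_ge0//.
by have := fC x y; rewrite ler_norml => /andP[].
Qed.

End Kernel.

Lemma fejer_cvg n (f : n.-tuple R -> R) (e : R) : torus_buc f -> 0 < e ->
  exists M, forall x, `|fejer M f x - f x| <= e.
Proof.
move=> tf e0; have bf := torus_buc_buc tf; have [[B fB] uf] := tf.
have B0 : 0 <= B by apply: le_trans (fB [tuple 0 | i < n]).
have e2 : 0 < e / 2 by rewrite divr_gt0.
have [d d0 h] := uf _ e2.
(* The cap 1/2 keeps 2 pi d' within [0, pi], where the cosine decreases strictly; hence [eta] >
   0. *)
pose d' := Num.min d (1 / 2).
have d'0 : 0 < d' by rewrite lt_min d0 divr_gt0.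
have d'2 : d' <= 1 / 2 by rewrite ge_min lexx orbT.
pose eta : R := 1 - cos (2 * pi * d').
have eta0 : 0 < eta by rewrite subr_gt0 cos_lt1_small.
(* If some coordinate of x - y is at least d' away from the integers, its term 1 - cos is at least
   [eta], and C * eta = 2 B covers the oscillation of [f]. *)
pose C := (B + B) / eta.
have C0 : 0 <= C by apply: divr_ge0; [exact: addr_ge0|exact: ltW].
have key x y : `|f y - f x| <=
    e / 2 + C * \sum_(i < n) (1 - cos (2 * pi * (tnth x i - tnth y i))).
  have ge0 i : 0 <= 1 - cos (2 * pi * (tnth x i - tnth y i)) by rewrite subr_ge0 cos_le1.
  have [xy|] := boolP [forall i, distZ (tnth x i - tnth y i) < d'].
    rewrite distrC (@le_trans _ _ (e / 2))//; last by rewrite lerDl mulr_ge0// sumr_ge0.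
    apply/ltW/h => i; have := forallP xy i; rewrite lt_min => /andP[]//.
  rewrite negb_forall => /existsP[i]; rewrite -leNgt => di.
  rewrite (le_trans (ler_normB _ _))// ler_wpDl ?(ltW e2)//.
  apply: (@le_trans _ _ (C * eta)).
    by rewrite /C divfK ?gt_eqF// lerD.
  rewrite ler_wpM2l// (bigD1 i)//= ler_wpDr ?sumr_ge0//.
  by rewrite lerB// le_cos_distZ// ltW.
(* Makes the second error term C n / (M + 1) at most e / 2. *)
pose M := Num.truncn (C * n%:R / (e / 2)).
exists M => x; have := @fejer_dist n M f (e / 2) C bf C0 key x.
move=> /le_trans; apply; rewrite [leRHS]splitr lerD2l mulrA ler_pdivrMr//.
rewrite [leRHS]mulrC -ler_pdivrMr//; apply/ltW.
exact: truncnS_gt.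
Qed.

End Fejer.

(** * The bilinear estimate for the line quadrature error *)

Section FiniteSums.
Variable R : realType.

Lemma sqr_sum_le (I : Type) (r : seq I) (a b : I -> R) :
  (\sum_(i <- r) a i * b i) ^+ 2 <=
  (\sum_(i <- r) a i ^+ 2) * (\sum_(i <- r) b i ^+ 2).
Proof.
elim: r => [|i r IH]; first by rewrite !big_nil expr0n mul0r.
rewrite !big_cons.
have A0 : 0 <= \sum_(i <- r) a i ^+ 2 by rewrite sumr_ge0// => *; exact: sqr_ge0.
have B0 : 0 <= \sum_(i <- r) b i ^+ 2 by rewrite sumr_ge0// => *; exact: sqr_ge0.
move: IH A0 B0; move: (\sum_(i <- r) _) (\sum_(i <- r) a i ^+ 2) (\sum_(i <- r) b i ^+ 2).
move=> S A B SAB A0 B0; set x := a i; set y := b i.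
(* AM-GM for A y^2 and x^2 B, whose product dominates (S x y)^2 by induction; squaring both sides
   avoids square roots. *)
have H : 2 * (S * (x * y)) <= A * y ^+ 2 + x ^+ 2 * B.
  have h0 : 0 <= A * y ^+ 2 + x ^+ 2 * B by rewrite addr_ge0// mulr_ge0// sqr_ge0.
  apply: (le_trans (ler_norm _)); rewrite -ler_sqr ?nnegrE//.
  rewrite real_normK ?num_real//.
  apply: (@le_trans _ _ (4 * (A * B) * (x * y) ^+ 2)).
    have -> : (2 * (S * (x * y))) ^+ 2 = 4 * S ^+ 2 * (x * y) ^+ 2 by ring.
    by rewrite ler_wpM2r ?sqr_ge0// ler_wpM2l.
  rewrite -subr_ge0 (_ : _ - _ = (A * y ^+ 2 - x ^+ 2 * B) ^+ 2) ?sqr_ge0//.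
  by ring.
have -> : (x * y + S) ^+ 2 = S ^+ 2 + 2 * (S * (x * y)) + x ^+ 2 * y ^+ 2 by ring.
have -> : (x ^+ 2 + A) * (y ^+ 2 + B) =
  A * B + (A * y ^+ 2 + x ^+ 2 * B) + x ^+ 2 * y ^+ 2 by ring.
by rewrite lerD2r lerD.
Qed.

Lemma sum_le_sqrt (I : Type) (r : seq I) (a b : I -> R) (A B : R) :
  0 <= A -> 0 <= B -> \sum_(i <- r) a i ^+ 2 <= A ^+ 2 ->
  \sum_(i <- r) b i ^+ 2 <= B ^+ 2 -> \sum_(i <- r) a i * b i <= A * B.
Proof.
move=> A0 B0 hA hB; apply: le_trans (ler_norm _) _.
rewrite -ler_sqr ?nnegrE ?mulr_ge0// real_normK ?num_real//.
apply: le_trans (sqr_sum_le _ _ _) _; rewrite exprMn ler_pM//.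
  by rewrite sumr_ge0// => *; exact: sqr_ge0.
by rewrite sumr_ge0// => *; exact: sqr_ge0.
Qed.

End FiniteSums.

Section Bilinear.
Variables (R : realType) (n : nat) (s : R).
Hypothesis s0 : 0 <= s.

Definition bessel (k : n.-tuple int) : R := 1 + 4 * pi ^+ 2 * knorm2 R k.
Definition bessel_half (k : n.-tuple int) : R := bessel k `^ (s / 2).

Lemma knorm2_ge0 (k : n.-tuple int) : 0 <= knorm2 R k.
Proof. by rewrite sumr_ge0// => *; exact: sqr_ge0. Qed.

Lemma bessel_ge1 k : 1 <= bessel k.
Proof. by rewrite lerDl mulr_ge0 ?knorm2_ge0// mulr_ge0// sqr_ge0. Qed.

Lemma bessel_half_gt0 k : 0 < bessel_half k.
Proof. by rewrite powR_gt0// (lt_le_trans _ (bessel_ge1 k)). Qed.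

Lemma bessel_half_sqr k : bessel_half k ^+ 2 = bessel k `^ s.
Proof.
have u0 : bessel k != 0 by rewrite gt_eqF// (lt_le_trans _ (bessel_ge1 k)).
by rewrite expr2 /bessel_half -powRD ?u0 ?implybT// -splitr.
Qed.

(* Peetre's inequality. *)
Lemma bessel_half_comb e (k l : n.-tuple int) : e ^+ 2 = 1 ->
  bessel_half (kcomb e k l) <= 4 `^ (s / 2) * (bessel_half k + bessel_half l).
Proof.
move=> e1.
have s2 : 0 <= s / 2 by rewrite divr_ge0.
have gt0 m : 0 <= bessel m by rewrite (le_trans _ (bessel_ge1 m)).
have K : knorm2 R (kcomb e k l) <= 2 * knorm2 R k + 2 * knorm2 R l.
  rewrite /knorm2 !mulr_sumr -big_split/=; apply: ler_sum => i _.
  rewrite tnth_mktuple rmorphD rmorphM/=.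
  have e1' : (e%:~R : R) ^+ 2 = 1 by rewrite -rmorphXn/= e1.
  have := sqr_ge0 ((tnth k i)%:~R - e%:~R * (tnth l i)%:~R : R).
  move: (e%:~R : R) e1' ((tnth k i)%:~R : R) ((tnth l i)%:~R : R) => z z1 a b.
  rewrite sqrrB sqrrD !exprMn z1 mul1r !mulr2n; lra.
have U : bessel (kcomb e k l) <= 4 * Num.max (bessel k) (bessel l).
  apply: (@le_trans _ _ (2 * bessel k + 2 * bessel l)).
    rewrite /bessel; have p0 : 0 <= 4 * pi ^+ 2 :> R by rewrite mulr_ge0// sqr_ge0.
    by have := ler_wpM2l p0 K; rewrite mulrDr; lra.
  have h1 : bessel k <= Num.max (bessel k) (bessel l) by rewrite le_max lexx.
  have h2 : bessel l <= Num.max (bessel k) (bessel l) by rewrite le_max lexx orbT.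
  by lra.
have m0 : 0 <= Num.max (bessel k) (bessel l) by rewrite le_max gt0.
apply: (@le_trans _ _ ((4 * Num.max (bessel k) (bessel l)) `^ (s / 2))).
  by apply: ge0_ler_powR; rewrite ?nnegrE// mulr_ge0.
rewrite powRM// ler_wpM2l ?powR_ge0//.
have hk := ltW (bessel_half_gt0 k); have hl := ltW (bessel_half_gt0 l).
by rewrite /Num.max; case: ifP => _; rewrite -/(bessel_half _) ?lerDl ?lerDr.
Qed.

Definition fourier_abs (f : n.-tuple R -> R) (k : n.-tuple int) : R :=
  Num.sqrt (rcos f k ^+ 2 + rsin f k ^+ 2).

Lemma fourier_abs_ge0 f k : 0 <= fourier_abs f k.
Proof. exact: sqrtr_ge0. Qed.

Lemma fourier_abs_sqr f k : fourier_abs f k ^+ 2 = rcos f k ^+ 2 + rsin f k ^+ 2.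
Proof. by rewrite sqr_sqrtr// addr_ge0// sqr_ge0. Qed.

(** The bound A on the H^s norm, tested on finite sets of frequencies. Distinctness of the
    frequencies is essential, and every later reindexing must preserve it. *)
Definition hsb (f : n.-tuple R -> R) (A : R) : Prop :=
  forall r : seq (n.-tuple int), uniq r ->
    \sum_(k <- r) bessel k `^ s * (rcos f k ^+ 2 + rsin f k ^+ 2) <= A ^+ 2.

Lemma hsbE f A r : hsb f A -> uniq r -> \sum_(k <- r) (bessel_half k * fourier_abs f k) ^+ 2 <= A ^+ 2.
Proof. by move=> h /h; under eq_bigr do rewrite -bessel_half_sqr -fourier_abs_sqr -exprMn. Qed.

Variable Z : R.
Hypothesis Z0 : 0 <= Z.
Hypothesis sumZ : forall r : seq (n.-tuple int), uniq r ->
  \sum_(k <- r) (bessel k `^ s)^-1 <= Z ^+ 2.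

(** Cauchy-Schwarz against the inverse weights: the embedding of H^s into the functions with
    absolutely summable Fourier series, with constant [Z]. *)
Lemma fourier_abs_l1 f A r : 0 <= A -> hsb f A -> uniq r -> \sum_(k <- r) fourier_abs f k <= A * Z.
Proof.
move=> A0 fA ur.
rewrite (eq_bigr (fun k => (bessel_half k * fourier_abs f k) * (bessel_half k)^-1)); last first.
  by move=> k _; rewrite mulrAC mulfV ?mul1r// gt_eqF// bessel_half_gt0.
apply: sum_le_sqrt => //; first exact: hsbE.
by under eq_bigr do rewrite exprVn bessel_half_sqr; exact: sumZ.
Qed.

Variables (N : n.-tuple int) (S : R).
Hypothesis S0 : 0 <= S.
Hypothesis sumS : forall r : seq (n.-tuple int), uniq r ->
  \sum_(k <- r) resonant R N k * (bessel k `^ s)^-1 <= S ^+ 2.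

Lemma resonant_ge0 m : 0 <= resonant R N m.
Proof. exact: ler0n. Qed.

Lemma resonant_idem m : resonant R N m ^+ 2 = resonant R N m.
Proof. by rewrite /resonant; case: (_ && _); rewrite ?expr1n ?expr0n. Qed.

(** Here [h] is a translation (or reflected translation) by the other frequency; injectivity keeps
    the shifted frequencies distinct, so the resonant sum is still at most S^2, uniformly in the
    shift. *)
Lemma resonant_cs f A r (h : n.-tuple int -> n.-tuple int) : 0 <= A -> hsb f A ->
  uniq r -> injective h ->
  \sum_(k <- r) (bessel_half k * fourier_abs f k) * (resonant R N (h k) / bessel_half (h k)) <= A * S.
Proof.
move=> A0 fA ur hi; apply: sum_le_sqrt => //; first exact: hsbE.
rewrite (eq_bigr (fun k => resonant R N (h k) * (bessel (h k) `^ s)^-1)); last first.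
  by move=> k _; rewrite exprMn resonant_idem exprVn bessel_half_sqr.
by rewrite -(big_map h xpredT (fun m => resonant R N m * (bessel m `^ s)^-1)) sumS// map_inj_uniq.
Qed.

(** The power of 4 comes from Peetre's inequality; the two equal terms correspond to the weight
    falling on k or on l. In each, [S] measures the resonant frequencies and [Z] the l^1 sum of the
    other factor. *)
Definition bilC (A B : R) : R := 4 `^ (s / 2) * (A * B * Z * S + A * B * Z * S).

Lemma kcomb_injl e (l : n.-tuple int) : injective (fun k => kcomb e k l).
Proof.
move=> k k' /(congr1 (fun t => tnth t)) E; apply/eq_from_tnth => i.
by have := congr1 (@^~ i) E; rewrite !tnth_mktuple => /addIr.
Qed.

Lemma kcomb_injr e (k : n.-tuple int) : e ^+ 2 = 1 -> injective (kcomb e k).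
Proof.
move=> e1 l l' /(congr1 (fun t => tnth t)) E; apply/eq_from_tnth => i.
have := congr1 (@^~ i) E; rewrite !tnth_mktuple => /addrI /(congr1 ( *%R e)).
by rewrite !mulrA -expr2 e1 !mul1r.
Qed.

(* Peetre's inequality moves the weight of the resonant frequency k + e l onto k or l;
   Cauchy-Schwarz is applied in the frequency that carries the weight, and the other
   one is summed in l^1. *)
Lemma resonant_double_sum f g A B e (r r' : seq (n.-tuple int)) : e ^+ 2 = 1 ->
  0 <= A -> 0 <= B -> hsb f A -> hsb g B -> uniq r -> uniq r' ->
  \sum_(k <- r) \sum_(l <- r') fourier_abs f k * fourier_abs g l * resonant R N (kcomb e k l) <= bilC A B.
Proof.
move=> e1 A0 B0 fA gB ur ur'.
pose q k l := resonant R N (kcomb e k l) / bessel_half (kcomb e k l).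
have q0 k l : 0 <= q k l by rewrite divr_ge0 ?resonant_ge0// ltW ?bessel_half_gt0.
have c0 : 0 <= 4 `^ (s / 2) :> R by exact: powR_ge0.
apply: (@le_trans _ _ (\sum_(k <- r) \sum_(l <- r') 4 `^ (s / 2) *
   (fourier_abs g l * ((bessel_half k * fourier_abs f k) * q k l) + fourier_abs f k * ((bessel_half l * fourier_abs g l) * q k l)))).
  apply: ler_sum => k _; apply: ler_sum => l _.
  have -> : fourier_abs f k * fourier_abs g l * resonant R N (kcomb e k l) =
     fourier_abs f k * fourier_abs g l * q k l * bessel_half (kcomb e k l).
    by rewrite /q mulrA divfK// gt_eqF// bessel_half_gt0.
  apply: (@le_trans _ _ (fourier_abs f k * fourier_abs g l * q k l * (4 `^ (s / 2) * (bessel_half k + bessel_half l)))).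
    apply: ler_wpM2l; last exact: bessel_half_comb.
    by apply: mulr_ge0 => //; apply: mulr_ge0; exact: fourier_abs_ge0.
  by rewrite le_eqVlt; apply/orP; left; apply/eqP; ring.
rewrite /bilC.
under eq_bigr do rewrite -mulr_sumr.
rewrite -mulr_sumr ler_wpM2l//.
under eq_bigr do rewrite big_split/=.
rewrite big_split/= lerD//.
  rewrite exchange_big/=.
  apply: (@le_trans _ _ (\sum_(l <- r') fourier_abs g l * (A * S))).
    apply: ler_sum => l _; rewrite -mulr_sumr ler_wpM2l ?fourier_abs_ge0//.
    exact: (resonant_cs A0 fA ur (@kcomb_injl e l)).
  rewrite -mulr_suml (le_trans (ler_wpM2r _ (fourier_abs_l1 B0 gB ur')))//.
    exact: mulr_ge0.
  by rewrite le_eqVlt; apply/orP; left; apply/eqP; ring.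
apply: (@le_trans _ _ (\sum_(k <- r) fourier_abs f k * (B * S))).
  apply: ler_sum => k _; rewrite -mulr_sumr ler_wpM2l ?fourier_abs_ge0//.
  exact: (resonant_cs B0 gB ur' (@kcomb_injr e k e1)).
rewrite -mulr_suml (le_trans (ler_wpM2r _ (fourier_abs_l1 A0 fA ur)))//.
  exact: mulr_ge0.
by rewrite le_eqVlt; apply/orP; left; apply/eqP; ring.
Qed.

Lemma buc_trig (a b : R) (k : n.-tuple int) :
  buc (fun x : n.-tuple R => a * cos (2 * pi * kdot k x) + b * sin (2 * pi * kdot k x)).
Proof. by apply: buc_lin; [exact: buc_cosk|exact: buc_sink]. Qed.

Lemma buc_fejer M f : buc (@fejer R n M f).
Proof. by apply: buc_sum => p; exact: buc_trig. Qed.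

(** Product-to-sum formulas: the sine parts have no error on the line, so only the cosine
    coefficients at k + l and k - l survive. *)
Lemma line_error_trig_mul (a b a' b' : R) (k l : n.-tuple int) :
  line_error N (fun x => (a * cos (2 * pi * kdot k x) + b * sin (2 * pi * kdot k x)) *
                   (a' * cos (2 * pi * kdot l x) + b' * sin (2 * pi * kdot l x))) =
  (a * a' - b * b') / 2 * resonant R N (kcomb 1 k l) +
  (a * a' + b * b') / 2 * resonant R N (kcomb (-1) k l).
Proof.
rewrite (_ : (fun x => _) = fun x =>
  1 * ((a * a' - b * b') / 2 * cos (2 * pi * kdot (kcomb 1 k l) x) +
       (a * b' + b * a') / 2 * sin (2 * pi * kdot (kcomb 1 k l) x)) +
  1 * ((a * a' + b * b') / 2 * cos (2 * pi * kdot (kcomb (-1) k l) x) +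
       (b * a' - a * b') / 2 * sin (2 * pi * kdot (kcomb (-1) k l) x))); last first.
  apply/funext => x; rewrite !kdot_comb.
  have -> : 2 * pi * (kdot k x + 1%:~R * kdot l x) = 2 * pi * kdot k x + 2 * pi * kdot l x by ring.
  have -> : 2 * pi * (kdot k x + (-1)%:~R * kdot l x) = 2 * pi * kdot k x - 2 * pi * kdot l x.
    by rewrite rmorphN/=; ring.
  move: (2 * pi * kdot k x) (2 * pi * kdot l x) => u v.
  by rewrite cosD cosB sinD sinB; field.
have [cp sp] := line_error_trig R N (kcomb 1 k l).
have [cm sm] := line_error_trig R N (kcomb (-1) k l).
rewrite line_error_lin; [|exact: buc_trig|exact: buc_trig].
rewrite line_error_lin; [|exact: buc_cosk|exact: buc_sink].
rewrite line_error_lin; [|exact: buc_cosk|exact: buc_sink].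
by rewrite cp sp cm sm !mulr0 !addr0 !mul1r.
Qed.

Lemma fourier_abs_pair f g k l (e : R) : e ^+ 2 = 1 ->
  `|rcos f k * rcos g l + e * (rsin f k * rsin g l)| <= fourier_abs f k * fourier_abs g l.
Proof.
move=> e1; rewrite -ler_sqr ?nnegrE ?mulr_ge0 ?fourier_abs_ge0// real_normK ?num_real//.
rewrite exprMn !fourier_abs_sqr -subr_ge0.
(* Lagrange's identity for two vectors of the plane; the correction with factor 1 - e^2 makes it a
   polynomial identity in [e] and then vanishes. *)
rewrite (_ : _ - _ = (rcos f k * rsin g l - e * (rsin f k * rcos g l)) ^+ 2 +
   (1 - e ^+ 2) * ((rsin f k * rsin g l) ^+ 2 + (rsin f k * rcos g l) ^+ 2)); last by ring.
by rewrite e1 subrr mul0r addr0 sqr_ge0.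
Qed.

Lemma freq_diff_uniq M (j : {ffun 'I_n -> 'I_M.+1}) :
  uniq [seq freq_diff (j, l) | l <- index_enum {ffun 'I_n -> 'I_M.+1}].
Proof.
rewrite map_inj_uniq ?index_enum_uniq// => l l' E; apply/ffunP => i.
move/(congr1 (fun t => tnth t i)): E; rewrite !tnth_mktuple/= => /addrI/oppr_inj[].
by move=> /val_inj.
Qed.

Lemma sum_fejer_weight M (c : R) : \sum_(j : {ffun 'I_n -> 'I_M.+1}) fejer_weight R n M * c = c.
Proof.
rewrite sumr_const -[LHS]mulr_natl mulrA [X in X * _](_ : _ = 1) ?mul1r//.
by apply: mulfV; rewrite gt_eqF// card_idx_gt0.
Qed.

(** Frequencies repeat over all pairs, but for fixed j and j' the differences j - l and j' - l' are
    distinct, so [resonant_double_sum] applies. Averaging over j and j' then costs nothing, and the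
    bound is uniform in M and M'. *)
Lemma line_error_fejer f g A B M M' : 0 <= A -> 0 <= B -> hsb f A -> hsb g B ->
  `|line_error N (fun x => fejer M f x * fejer M' g x)| <= bilC A B.
Proof.
move=> A0 B0 fA gB.
have fM := fejer_weight_gt0 R n M; have fM' := fejer_weight_gt0 R n M'.
rewrite [X in line_error N X](_ : _ = fun x =>
   \sum_(p : {ffun 'I_n -> 'I_M.+1} * {ffun 'I_n -> 'I_M.+1})
   \sum_(q : {ffun 'I_n -> 'I_M'.+1} * {ffun 'I_n -> 'I_M'.+1})
   ((fejer_weight R n M * rcos f (freq_diff p) * cos (2 * pi * kdot (freq_diff p) x) +
     fejer_weight R n M * rsin f (freq_diff p) * sin (2 * pi * kdot (freq_diff p) x)) *
    (fejer_weight R n M' * rcos g (freq_diff q) * cos (2 * pi * kdot (freq_diff q) x) +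
     fejer_weight R n M' * rsin g (freq_diff q) * sin (2 * pi * kdot (freq_diff q) x)))); last first.
  by apply/funext => x; rewrite big_distrlr.
rewrite line_error_sum; last by move=> p; apply: buc_sum => q; apply: buc_mul; exact: buc_trig.
under eq_bigr => p _.
  rewrite line_error_sum; last by move=> q; apply: buc_mul; exact: buc_trig.
  under eq_bigr do rewrite line_error_trig_mul.
  over.
pose t k l := fourier_abs f k * fourier_abs g l * resonant R N (kcomb 1 k l) + fourier_abs f k * fourier_abs g l * resonant R N (kcomb (-1) k l).
apply: (@le_trans _ _ (\sum_(p : {ffun 'I_n -> 'I_M.+1} * {ffun 'I_n -> 'I_M.+1})
   \sum_(q : {ffun 'I_n -> 'I_M'.+1} * {ffun 'I_n -> 'I_M'.+1})
   fejer_weight R n M * fejer_weight R n M' / 2 * t (freq_diff p) (freq_diff q))).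
  rewrite (le_trans (ler_norm_sum _ _ _))//; apply: ler_sum => p _.
  rewrite (le_trans (ler_norm_sum _ _ _))//; apply: ler_sum => q _.
  move: (freq_diff p) (freq_diff q) => k l.
  rewrite (_ : _ + _ = fejer_weight R n M * fejer_weight R n M' / 2 *
    ((rcos f k * rcos g l + (-1) * (rsin f k * rsin g l)) * resonant R N (kcomb 1 k l) +
     (rcos f k * rcos g l + 1 * (rsin f k * rsin g l)) * resonant R N (kcomb (-1) k l))); last by field.
  rewrite normrM ger0_norm ?divr_ge0 ?mulr_ge0 ?(ltW fM) ?(ltW fM')//.
  rewrite ler_wpM2l ?divr_ge0 ?mulr_ge0 ?(ltW fM) ?(ltW fM')//.
  rewrite (le_trans (ler_normD _ _))// !normrM !(ger0_norm (resonant_ge0 _)).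
  by rewrite lerD// ler_wpM2r ?resonant_ge0// fourier_abs_pair ?sqrrN ?expr1n.
rewrite -(pair_bigA _ (fun j l => \sum_q fejer_weight R n M * fejer_weight R n M' / 2 * t (freq_diff (j, l)) (freq_diff q)))/=.
apply: (@le_trans _ _ (\sum_(j : {ffun 'I_n -> 'I_M.+1}) \sum_(j' : {ffun 'I_n -> 'I_M'.+1})
    fejer_weight R n M * fejer_weight R n M' * bilC A B)).
  apply: ler_sum => j _.
  under eq_bigr => l _ do
    rewrite -(pair_bigA _ (fun j' l' => fejer_weight R n M * fejer_weight R n M' / 2 * t (freq_diff (j, l)) (freq_diff (j', l')))).
  rewrite exchange_big/=; apply: ler_sum => j' _.
  under eq_bigr do rewrite -mulr_sumr.
  rewrite -mulr_sumr -!mulrA ler_wpM2l ?(ltW fM)// ler_wpM2l ?(ltW fM')//.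
  rewrite mulrC ler_pdivrMr// mulr_natr mulr2n.
  under eq_bigr do rewrite big_split/=.
  rewrite big_split/=.
  have U := freq_diff_uniq j; have U' := freq_diff_uniq j'.
  have K e : e ^+ 2 = 1 -> \sum_l \sum_l' fourier_abs f (freq_diff (j, l)) * fourier_abs g (freq_diff (j', l')) *
      resonant R N (kcomb e (freq_diff (j, l)) (freq_diff (j', l'))) <= bilC A B.
    move=> e1; have := resonant_double_sum e1 A0 B0 fA gB U U'.
    by rewrite big_map; under eq_bigr do rewrite big_map.
  by rewrite lerD// K// ?sqrrN expr1n.
under eq_bigr do (under eq_bigr do rewrite -mulrA mulrCA; rewrite sum_fejer_weight).
by rewrite sum_fejer_weight.
Qed.

Lemma line_error_bilinear f g A B : 0 <= A -> 0 <= B -> torus_buc f -> torus_buc g -> hsb f A -> hsb g B ->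
  `|line_error N (fun x => f x * g x)| <= bilC A B.
Proof.
move=> A0 B0 tf tg fA gB; apply/ler_addgt0Pr => e e0.
have [[Bf fB] _] := tf; have [[Bg gB'] _] := tg.
have Bf0 : 0 <= Bf by apply: le_trans (fB [tuple 0 | i < n]).
have Bg0 : 0 <= Bg by apply: le_trans (gB' [tuple 0 | i < n]).
(* With d <= 1 the Fejer mean of g is bounded by Bg + 1, so the two products differ by at most d (Bf
   + Bg + 1) <= e / 2; [line_error_dist] doubles this to e. *)
pose d := Num.min 1 (e / 2 / (Bf + Bg + 1)).
have D0 : 0 < Bf + Bg + 1 by rewrite ltr_wpDl// addr_ge0.
have d0 : 0 < d by rewrite lt_min ltr01 !divr_gt0.
have d1 : d <= 1 by rewrite ge_min lexx.
have de : d * (Bf + Bg + 1) <= e / 2 by rewrite -ler_pdivlMr// ge_min lexx orbT.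
have [M FM] := fejer_cvg tf d0; have [M' GM] := fejer_cvg tg d0.
have H : forall x, `|f x * g x - fejer M f x * fejer M' g x| <= e / 2.
  move=> x; apply: le_trans de.
  have -> : f x * g x - fejer M f x * fejer M' g x =
    - (f x * (fejer M' g x - g x)) - (fejer M f x - f x) * (g x + (fejer M' g x - g x)) by ring.
  rewrite (le_trans (ler_normB _ _))// normrN !normrM.
  apply: (@le_trans _ _ (Bf * d + d * (Bg + 1))); last first.
    by rewrite le_eqVlt; apply/orP; left; apply/eqP; ring.
  rewrite lerD// ler_pM//.
  by rewrite (le_trans (ler_normD _ _))// lerD// (le_trans (GM x)).
have L := line_error_dist N (buc_mul (torus_buc_buc tf) (torus_buc_buc tg))
  (buc_mul (@buc_fejer M f) (@buc_fejer M' g)) H.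
rewrite -splitr in L.
have K := @line_error_fejer f g A B M M' A0 B0 fA gB.
rewrite -(subrK (line_error N (fun x => fejer M f x * fejer M' g x)) (line_error N (fun x => f x * g x))).
by rewrite (le_trans (ler_normD _ _))// addrC lerD.
Qed.

End Bilinear.

(** * The orthogonal lattice of (1, q, ..., q^(n-1)) *)

Section Summability.
Variable R : realType.

Lemma ler_sum_subset (T : eqType) (F : T -> R) (r r' : seq T) :
  (forall k, 0 <= F k) -> uniq r -> {subset r <= r'} ->
  \sum_(k <- r) F k <= \sum_(k <- r') F k.
Proof.
move=> F0; elim: r r' => [|k r IH] r' /=.
  by move=> _ _; rewrite big_nil sumr_ge0.
move=> /andP[kr ur] sub.
have kr' : k \in r' by apply: sub; rewrite mem_head.
rewrite (perm_big _ (perm_to_rem kr')) !big_cons lerD2l IH// => x xr.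
have xr' : x \in r' by apply: sub; rewrite in_cons xr orbT.
have := xr'; rewrite (perm_mem (perm_to_rem kr')) in_cons => /orP[/eqP xk|//].
by rewrite -xk xr in kr.
Qed.

(* From (1 + 1/m)^b = exp (b ln (1 + 1/m)) >= 1 + b / (m + 1). *)
Lemma powRN_telescope (b : R) (m : nat) : 0 < b ->
  (m.+2%:R `^ (b + 1))^-1 <= b^-1 * ((m.+1%:R `^ b)^-1 - (m.+2%:R `^ b)^-1).
Proof.
move=> b0; have x0 : 0 < m.+1%:R :> R by [].
have y0 : 0 < m.+2%:R :> R by [].
pose x : R := m.+1%:R; pose y : R := m.+2%:R.
have yx : y = x + 1 by rewrite /y /x natr1.
have H : 1 + b / y <= y `^ b / x `^ b.
  have -> : y `^ b / x `^ b = expR (b * (ln y - ln x)).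
    by rewrite /powR !gt_eqF// mulrBr expRD expRN.
  apply: (le_trans _ (expR_ge1Dx _)); rewrite lerD2l ler_pM2l//.
  have := @le_ln1Dx R (- y^-1).
  have -> : 1 + - y^-1 = x / y.
    have -> : x = y - 1 by rewrite yx addrK.
    by rewrite mulrBl mul1r divff// gt_eqF.
  rewrite ltrN2 invf_lt1// ltr1n => /(_ isT).
  by rewrite ln_div ?posrE// lerNr opprB.
have xb : 0 < x `^ b by rewrite powR_gt0.
have yb : 0 < y `^ b by rewrite powR_gt0.
have -> : m.+2%:R `^ (b + 1) = y `^ b * y.
  rewrite powRD; first by rewrite powRr1 ?ler0n.
  by rewrite pnatr_eq0 implybT.
rewrite -/x -/y.
have -> : b^-1 * ((x `^ b)^-1 - (y `^ b)^-1) =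
  (b^-1 * (y `^ b / x `^ b - 1)) * (y `^ b)^-1.
  by field; rewrite !gt_eqF.
rewrite invfM mulrC ler_wpM2r ?invr_ge0 ?(ltW yb)//.
by rewrite ler_pdivlMl// lerBrDl.
Qed.

Lemma riemann_sum_bound (a : R) : 1 < a -> forall M,
  \sum_(m < M) (m.+1%:R `^ a)^-1 <= 1 + (a - 1)^-1.
Proof.
move=> a1 M; have b0 : 0 < a - 1 by rewrite subr_gt0.
have I0 : 0 <= (a - 1)^-1 by rewrite invr_ge0 ltW.
case: M => [|M]; first by rewrite big_ord0 addr_ge0.
(* The induction goes through once the telescoped remainder is kept in the bound. *)
suff : \sum_(m < M.+1) (m.+1%:R `^ a)^-1 <=
    1 + (a - 1)^-1 * (1 - (M.+1%:R `^ (a - 1))^-1).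
  move=> /le_trans; apply; by rewrite lerD2l ler_piMr// gerBl ?invr_ge0 ?powR_ge0.
elim: M => [|M IH].
  by rewrite big_ord_recl big_ord0 !powR1 invr1 subrr mulr0.
have := powRN_telescope M b0; rewrite [_ - 1 + 1]subrK => K.
rewrite big_ord_recr/=; apply: le_trans (lerD IH K) _.
by rewrite -addrA -mulrDr addrA subrK.
Qed.

Definition decay (p : R) (j : int) : R := ((1 + j%:~R ^+ 2) `^ p)^-1.

Lemma decay_ge0 p j : 0 <= decay p j.
Proof. by rewrite invr_ge0 powR_ge0. Qed.

Lemma decay_le p (m : nat) (j : int) : 0 <= p -> `|j|%N = m.+1 ->
  decay p j <= (m.+1%:R `^ (2 * p))^-1.
Proof.
move=> p0 jm.
have -> : (2 : R) = 2%:R by [].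
rewrite powRrM powR_mulrn//.
have -> : (m.+1%:R : R) ^+ 2 = j%:~R ^+ 2.
  by rewrite -jm natr_absz intr_norm real_normK ?num_real.
rewrite lef_pV2 ?posrE ?powR_gt0//.
- by apply: ge0_ler_powR => //; rewrite ?nnegrE ?addr_ge0 ?sqr_ge0// lerDr.
- by rewrite ltr_wpDr// sqr_ge0.
- by rewrite exprn_even_gt0//= intr_eq0 -absz_eq0 jm.
Qed.

(** The index i stands for i - M, which runs from -M to M. In the bound [G], the leading 1 is the
    term at zero and the factor 2 accounts for the two new ends in passing from M to M + 1. *)
Lemma decay_sum (p : R) : 1 < 2 * p -> exists2 G : R, 0 < G &
  forall M, \sum_(i < (M + M).+1) decay p ((i : nat)%:Z - M%:Z) <= G.
Proof.
move=> p1; have p0 : 0 <= p by lra.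
have g0 : 0 < 1 + (2 * p - 1)^-1 by rewrite ltr_pwDl// invr_ge0 subr_ge0 ltW.
exists (1 + (1 + (2 * p - 1)^-1) * 2); first by rewrite ltr_pwDl// mulr_ge0// ltW.
move=> M.
apply: (@le_trans _ _ (1 + (\sum_(m < M) (m.+1%:R `^ (2 * p))^-1) * 2)); last first.
  by rewrite lerD2l ler_wpM2r// riemann_sum_bound.
elim: M => [|M IH].
  by rewrite big_ord_recl !big_ord0 mul0r !addr0 /decay ?subrr expr0n addr0 powR1 invr1.
have -> : (M.+1 + M.+1).+1 = (M + M).+3 by lia.
rewrite big_ord_recl big_ord_recr/= [X in _ <= 1 + X * 2]big_ord_recr/=.
rewrite (eq_bigr (fun i : 'I_(M + M).+1 => decay p ((i : nat)%:Z - M%:Z))); last first.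
  by move=> i _; rewrite /bump/= add1n; congr decay; lia.
have h1 : decay p (0%N%:Z - M.+1%:Z) <= (M.+1%:R `^ (2 * p))^-1.
  by apply: decay_le => //; lia.
have h2 : decay p ((bump 0 (M + M).+1)%:Z - M.+1%:Z) <= (M.+1%:R `^ (2 * p))^-1.
  by apply: decay_le => //; rewrite /bump; lia.
lra.
Qed.

Definition bracket n (k : n.-tuple int) : R := 1 + knorm2 R k.

Lemma bracket_ge1 n (k : n.-tuple int) : 1 <= bracket k.
Proof. by rewrite lerDl knorm2_ge0. Qed.

Lemma bracket_prod n (s : R) (k : n.-tuple int) : (0 < n)%N -> 0 <= s ->
  (bracket k `^ s)^-1 <= \prod_(i < n) decay (s / n%:R) (tnth k i).
Proof.
move=> n0 s0; have u0 : 0 <= bracket k by rewrite (le_trans _ (bracket_ge1 k)).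
have p0 : 0 <= s / n%:R by rewrite divr_ge0.
have -> : bracket k `^ s = \prod_(i < n) bracket k `^ (s / n%:R).
  rewrite prodr_const card_ord -powR_mulrn ?powR_ge0// -powRrM divfK//.
  by rewrite pnatr_eq0 -lt0n.
rewrite -prodfV; apply: ler_prod => i _; rewrite invr_ge0 powR_ge0/=.
rewrite /decay lef_pV2 ?posrE ?powR_gt0//.
- apply: ge0_ler_powR => //; rewrite ?nnegrE// ?addr_ge0 ?sqr_ge0//.
  rewrite lerD2l /knorm2 (bigD1 i)//= lerDl sumr_ge0// => *; exact: sqr_ge0.
- by rewrite (lt_le_trans _ (bracket_ge1 k)).
- by rewrite ltr_wpDr// sqr_ge0.
Qed.

(* (1 + |k|^2)^n >= prod_i (1 + k_i^2) reduces to a product of one-dimensional sums. *)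
Lemma lattice_summable n (s : R) : (0 < n)%N -> n%:R / 2 < s ->
  exists2 G : R, 0 < G & forall r : seq (n.-tuple int), uniq r ->
    \sum_(k <- r) (bracket k `^ s)^-1 <= G.
Proof.
move=> n0 sn.
have n0' : 0 < n%:R :> R by rewrite ltr0n.
have s0 : 0 <= s by rewrite ltW// (le_lt_trans _ sn)// divr_ge0.
have p1 : 1 < 2 * (s / n%:R).
  by rewrite mulrA ltr_pdivlMr// mul1r mulrC -ltr_pdivrMr.
have [G G0 HG] := decay_sum p1.
exists (G ^+ n); first exact: exprn_gt0.
move=> r ur.
(* The list [r] lies in the cube of side 2 M + 1 centred at 0, whose sum factors over the
   coordinates. *)
pose M := \max_(k <- r) \max_(i < n) `|tnth k i|%N.
have kM k i : k \in r -> (`|tnth k i| <= M)%N.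
  move=> kr; apply: (@leq_trans (\max_(i < n) `|tnth k i|%N)).
    exact: (@leq_bigmax _ (fun i => `|tnth k i|%N)).
  exact: (@leq_bigmax_seq _ r xpredT (fun k => \max_(i < n) `|tnth k i|%N) k kr isT).
pose T := {ffun 'I_n -> 'I_(M + M).+1}.
pose h (f : T) : n.-tuple int := [tuple (f i : nat)%:Z - M%:Z | i < n].
pose F (k : n.-tuple int) : R := \prod_(i < n) decay (s / n%:R) (tnth k i).
apply: (@le_trans _ _ (\sum_(k <- r) F k)).
  by apply: ler_sum => k _; exact: bracket_prod.
apply: (@le_trans _ _ (\sum_(k <- [seq h f | f <- index_enum T]) F k)).
  apply: ler_sum_subset => // [k|k kr].
    by apply: prodr_ge0 => i _; exact: decay_ge0.
  apply/mapP; exists [ffun i => inord (absz (tnth k i + M%:Z))].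
    by rewrite mem_index_enum.
  apply/eq_from_tnth => i; rewrite tnth_mktuple ffunE inordK; last first.
    by have := kM k i kr; lia.
  by have := kM k i kr; lia.
rewrite big_map.
rewrite (eq_bigr (fun f : T => \prod_(i < n) decay (s / n%:R) ((f i : nat)%:Z - M%:Z))); last first.
  by move=> f _; apply: eq_bigr => i _; rewrite tnth_mktuple.
rewrite -(bigA_distr_bigA (fun (i : 'I_n) (j : 'I_(M + M).+1) => decay (s / n%:R) ((j : nat)%:Z - M%:Z))).
rewrite prodr_const card_ord; apply: lerXn2r; rewrite ?nnegrE ?(ltW G0)//.
by apply: sumr_ge0 => j _; exact: decay_ge0.
Qed.

End Summability.

(** * Korobov vectors: separation in the orthogonal lattice and the sum over its nonzero points *)

Section Korobov.
Variables (R : realType) (n q : nat).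
Hypothesis q0 : (0 < q)%N.

Definition korobov : n.-tuple int := [tuple (q ^ i)%N%:Z | i < n].

(** Uniqueness of signed base-q digits: modulo q only the lowest digit remains, and being smaller
    than q in absolute value it vanishes; divide by q and repeat. *)
Lemma digits_eq0 m (a : 'I_m -> int) : \sum_(i < m) a i * (q ^ i)%N%:Z = 0 ->
  (forall i, (`|a i| < q)%N) -> forall i, a i = 0.
Proof.
elim: m a => [|m IH] a; first by move=> _ _ [].
rewrite big_ord_recl expn0 mulr1 => E aq.
pose T := \sum_(i < m) a (lift ord0 i) * (q ^ i)%N%:Z.
have {}E : a ord0 + T * q%:Z = 0.
  rewrite -[RHS]E /T mulr_suml; congr (_ + _); apply: eq_bigr => i _.
  by rewrite -mulrA /= /bump/= add1n expnS PoszM [q%:Z * _]mulrC.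
have a0 : a ord0 = 0.
  apply/eqP; rewrite -absz_eq0; apply/negPn/negP; rewrite -lt0n => a0.
  have : (q %| `|a ord0|)%N.
    have -> : a ord0 = (- T) * q%:Z by rewrite mulNr; apply/eqP; rewrite -addr_eq0 E.
    by rewrite abszM dvdn_mull.
  by move/(dvdn_leq a0); rewrite leqNgt aq.
move=> i; case: (unliftP ord0 i) => [j ->|->//].
apply: (IH (fun j => a (lift ord0 j))) => [|k]; last exact: aq.
move: E; rewrite a0 add0r => /eqP; rewrite mulf_eq0 => /orP[/eqP//|].
by rewrite eqz_nat gtn_eqF.
Qed.

Lemma zdot_korobov_eq0 (m : n.-tuple int) : zdot m korobov = 0 ->
  (forall i, (`|tnth m i| < q)%N) -> m = zero_freq n.
Proof.
move=> E mq; apply/eq_from_tnth => i; rewrite tnth_mktuple.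
apply: (digits_eq0 _ mq); rewrite -[RHS]E; apply: eq_bigr => j _.
by rewrite tnth_mktuple.
Qed.

Definition cell (k : n.-tuple int) : n.-tuple int := [tuple (tnth k i %/ q)%Z | i < n].

Lemma cell_inj : {in [pred k | zdot k korobov == 0] &, injective cell}.
Proof.
move=> k k'; rewrite !inE => /eqP kL /eqP k'L E.
have : kcomb (-1) k k' = zero_freq n.
  apply: zdot_korobov_eq0.
    transitivity (zdot k korobov - zdot k' korobov); last by rewrite kL k'L subrr.
    rewrite /zdot -sumrB; apply: eq_bigr => i _.
    by rewrite tnth_mktuple mulN1r mulrBl.
  move=> i; rewrite tnth_mktuple mulN1r.
  have := congr1 (fun t => tnth t i) E; rewrite !tnth_mktuple => Ei.
  have qz : q%:Z != 0 by rewrite eqz_nat -lt0n.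
  have h1 := modz_ge0 (tnth k i) qz; have h2 := modz_ge0 (tnth k' i) qz.
  have qp : 0 < q%:Z by rewrite ltz_nat.
  have h3 := ltz_pmod (tnth k i) qp; have h4 := ltz_pmod (tnth k' i) qp.
  have e1 := divz_eq (tnth k i) q; have e2 := divz_eq (tnth k' i) q.
  rewrite Ei in e1.
  move: h1 h2 h3 h4 e1 e2.
  move: (tnth k i %% q)%Z (tnth k' i %% q)%Z ((tnth k' i %/ q)%Z * q) => x y z.
  lia.
move=> E0; apply/eq_from_tnth => i.
have := congr1 (fun t => tnth t i) E0; rewrite !tnth_mktuple mulN1r.
by move/eqP; rewrite subr_eq0 => /eqP.
Qed.

Lemma korobov_far (k : n.-tuple int) : zdot k korobov = 0 -> k != zero_freq n ->
  q%:R ^+ 2 <= knorm2 R k.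
Proof.
move=> kL; apply: contraNT; rewrite -ltNge => H; apply/eqP.
apply: zdot_korobov_eq0 => // i; rewrite ltnNge; apply/negP => qi.
move: H; rewrite ltNge => /negP; apply.
rewrite /knorm2 (bigD1 i)//= ler_wpDr//.
  by apply: sumr_ge0 => *; exact: sqr_ge0.
rewrite -[leRHS]real_normK ?num_real// lerXn2r ?nnegrE//.
by rewrite -intr_norm -abszE ler_nat.
Qed.

(** Rounding down to a multiple of q gives q^2 |cell k|^2 <= 2 |k|^2 + 2 n q^2. The additive terms
    q^2 + 2 n q^2 are absorbed by q^2 <= |k|^2 from [korobov_far], whence the constant 2 n + 3. *)
Lemma cell_norm (k : n.-tuple int) : zdot k korobov = 0 -> k != zero_freq n ->
  q%:R ^+ 2 * bracket R (cell k) <= (n + n + 3)%:R * knorm2 R k.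
Proof.
move=> kL kn; have far := korobov_far kL kn.
have H : q%:R ^+ 2 * knorm2 R (cell k) <= 2 * knorm2 R k + 2 * (n%:R * q%:R ^+ 2).
  rewrite /knorm2 mulr_sumr.
  have -> : n%:R * q%:R ^+ 2 = \sum_(i < n) (q%:R : R) ^+ 2.
    by rewrite sumr_const card_ord [LHS]mulr_natl.
  rewrite !mulr_sumr -big_split/=; apply: ler_sum => i _; rewrite tnth_mktuple.
  have qz : q%:Z != 0 by rewrite eqz_nat -lt0n.
  have h1 := modz_ge0 (tnth k i) qz.
  have h3 : (tnth k i %% q)%Z < q%:Z by rewrite ltz_pmod// ltz_nat.
  have e1 := divz_eq (tnth k i) q.
  move: h1 h3 e1; move: (tnth k i) (tnth k i %% q)%Z (tnth k i %/ q)%Z => j x z.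
  move=> x0 xq ->.
  have x0' : 0 <= x%:~R :> R by rewrite ler0z.
  have xq' : x%:~R <= q%:R :> R by have := ltW xq; rewrite -(ler_int R).
  rewrite rmorphD rmorphM/=.
  move: x0' xq'; move: (x%:~R : R) (z%:~R : R); rewrite -[(q%:Z)%:~R]/(q%:R).
  move: (q%:R : R) => Q X Y X0 XQ.
  have : X ^+ 2 <= Q ^+ 2 by rewrite lerXn2r ?nnegrE// (le_trans X0).
  have := sqr_ge0 (Y * Q + X + X).
  nra.
rewrite /bracket mulrDr mulr1 !natrD !mulrDl.
have n0 : 0 <= n%:R :> R by [].
have := ler_wpM2l n0 far.
lra.
Qed.

(* Each cube of side q contains at most one point of the orthogonal lattice, so the sum
   is controlled by the sum over the cubes. *)
Lemma korobov_sum (s G : R) : 0 <= s ->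
  (forall r : seq (n.-tuple int), uniq r -> \sum_(k <- r) (bracket R k `^ s)^-1 <= G) ->
  forall r : seq (n.-tuple int), uniq r ->
  \sum_(k <- r) resonant R korobov k * (bessel R k `^ s)^-1 <=
  (Num.sqrt ((n + n + 3)%:R `^ s * G) * (q%:R `^ s)^-1) ^+ 2.
Proof.
move=> s0 HG r ur.
have G0 : 0 <= G by have := HG [::] isT; rewrite big_nil.
have c0 : 0 < (n + n + 3)%:R :> R by rewrite ltr0n addnS.
have Q0 : 0 < q%:R :> R by rewrite ltr0n.
rewrite exprMn sqr_sqrtr ?mulr_ge0 ?powR_ge0//.
have -> : (q%:R `^ s)^-1 ^+ 2 = ((q%:R ^+ 2) `^ s)^-1 :> R.
  by rewrite exprVn !expr2 powRM// ltW.
pose L := [seq k <- r | (zdot k korobov == 0) && (k != zero_freq n)].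
have -> : \sum_(k <- r) resonant R korobov k * (bessel R k `^ s)^-1 =
    \sum_(k <- L) (bessel R k `^ s)^-1.
  rewrite big_filter [RHS]big_mkcond; apply: eq_bigr => k _.
  by rewrite /resonant; case: ifP => _; rewrite ?mul1r ?mul0r.
apply: (@le_trans _ _ (\sum_(k <- L) (n + n + 3)%:R `^ s * ((q%:R ^+ 2) `^ s)^-1 *
   (bracket R (cell k) `^ s)^-1)).
  rewrite big_seq [leRHS]big_seq; apply: ler_sum => k.
  rewrite mem_filter => /andP[/andP[/eqP kL kn] _].
  have H := cell_norm kL kn.
  have ug : 0 < bracket R (cell k) by rewrite (lt_le_trans _ (bracket_ge1 R _)).
  have uu : 0 < bessel R k by rewrite (lt_le_trans _ (bessel_ge1 R _)).
  have ku : knorm2 R k <= bessel R k.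
    have p2 := @pi_ge2 R; have p4 : 1 <= 4 * pi ^+ 2 :> R by rewrite expr2; nra.
    by rewrite /bessel ler_wpDl// ler_peMl// knorm2_ge0.
  have H1 : (q%:R ^+ 2 * bracket R (cell k)) `^ s <= ((n + n + 3)%:R * bessel R k) `^ s.
    apply: ge0_ler_powR; rewrite ?nnegrE ?mulr_ge0 ?(ltW ug) ?(ltW uu) ?sqr_ge0//.
    by apply: le_trans H _; rewrite ler_wpM2l.
  move: H1; rewrite (powRM s (sqr_ge0 _) (ltW ug)) (powRM s (ltW c0) (ltW uu)).
  have : 0 < (q%:R ^+ 2) `^ s :> R by rewrite powR_gt0// exprn_gt0.
  have : 0 < bracket R (cell k) `^ s by rewrite powR_gt0.
  have : 0 < bessel R k `^ s by rewrite powR_gt0.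
  have : 0 < (n + n + 3)%:R `^ s :> R by rewrite powR_gt0.
  move: ((n + n + 3)%:R `^ s) (bessel R k `^ s) (bracket R _ `^ s) ((q%:R ^+ 2) `^ s).
  move=> a b c d a0 b0 c0' d0 K.
  rewrite -mulrA -invfM.
  by rewrite ler_pdivlMr ?mulr_gt0// mulrC ler_pdivrMr.
rewrite -mulr_sumr [leRHS]mulrAC ler_wpM2l ?mulr_ge0 ?invr_ge0 ?powR_ge0//.
rewrite -(big_map cell xpredT (fun k => (bracket R k `^ s)^-1)) HG// map_inj_in_uniq.
  exact: filter_uniq.
move=> k k'; rewrite !mem_filter => /andP[/andP[h _] _] /andP[/andP[h' _] _].
by apply: cell_inj; rewrite inE.
Qed.

End Korobov.

(** * Uniform continuity on the torus and in the RKHS *)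

Section UniformContinuity.
Variables (R : realType) (n : nat).
Implicit Types (f : n.-tuple R -> R) (x y : n.-tuple R).

Lemma tdist_le_sum x y : tdist x y <= \sum_(i < n) distZ (tnth x i - tnth y i).
Proof.
have S0 : 0 <= \sum_(i < n) distZ (tnth x i - tnth y i).
  by apply: sumr_ge0 => i _; exact: distZ_ge0.
rewrite -[leRHS]ger0_norm// -sqrtr_sqr ler_wsqrtr// expr2 mulr_suml.
apply: ler_sum => i _; rewrite expr2 ler_wpM2l ?distZ_ge0// (bigD1 i)//= lerDl.
by apply: sumr_ge0 => j _; exact: distZ_ge0.
Qed.

Lemma distZ_le_tdist x y i : distZ (tnth x i - tnth y i) <= tdist x y.
Proof.
rewrite -[leLHS]ger0_norm ?distZ_ge0// -sqrtr_sqr ler_wsqrtr// (bigD1 i)//= lerDl.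
by apply: sumr_ge0 => j _; exact: sqr_ge0.
Qed.

Lemma tdist_lt_distZ x y (del : R) : 0 < del ->
  (forall i, distZ (tnth x i - tnth y i) < del / n.+1%:R) -> tdist x y < del.
Proof.
move=> d0 h; apply: le_lt_trans (tdist_le_sum _ _) _.
apply: (@le_lt_trans _ _ (\sum_(i < n) del / n.+1%:R)).
  by apply: ler_sum => i _; exact: ltW.
rewrite sumr_const card_ord -[ltLHS]mulr_natl mulrA ltr_pdivrMr// mulrC ltr_pM2l//.
by rewrite ltr_nat.
Qed.

Definition fpart x : n.-tuple R :=
  tshift x [tuple - Num.floor (tnth x i) | i < n].

Lemma fpart_itv x i : 0 <= tnth (fpart x) i <= 1.
Proof.
rewrite !tnth_mktuple rmorphN/= subr_ge0 floor_le/= lerBlDr addrC.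
by have := floorD1_gt (tnth x i); rewrite rmorphD/= => /ltW.
Qed.

Lemma distZ_fpartl x (a : R) i : distZ (tnth (fpart x) i - a) = distZ (tnth x i - a).
Proof. by rewrite tnth_mktuple addrAC distZD_int. Qed.

Lemma distZ_fpartr x (a : R) i : distZ (a - tnth (fpart x) i) = distZ (a - tnth x i).
Proof. by rewrite -distZN opprB distZ_fpartl -distZN opprB. Qed.

Lemma tdist_fpart x y : tdist (fpart x) (fpart y) = tdist x y.
Proof.
congr Num.sqrt; apply: eq_bigr => i _.
by rewrite distZ_fpartl distZ_fpartr.
Qed.

Lemma cube_compact : compact [set v : 'rV[R]_n | forall i, `[(0 : R), 1]%classic (v ord0 i)].
Proof. by apply: (@rV_compact R n (fun=> `[0, 1]%classic)) => i; exact: segment_compact. Qed.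

Definition row_tuple (v : 'rV[R]_n) : n.-tuple R := [tuple v ord0 i | i < n].

Lemma cube_uniform f (e : R) : tcontinuous f -> 0 < e ->
  exists2 del : R, 0 < del & forall v : 'rV[R]_n,
    (forall i, `[(0 : R), 1]%classic (v ord0 i)) ->
    forall y, (forall i, distZ (v ord0 i - tnth y i) < del) ->
      `|f (row_tuple v) - f y| < e.
Proof.
move=> cf e0.
have /compact_near_coveringP/(_ R 0^'+ (fun del v => forall y,
  (forall i, distZ (v ord0 i - tnth y i) < del) -> `|f (row_tuple v) - f y| < e) _)
  := cube_compact.
case.
  move=> v _; have e2 : 0 < e / 2 by rewrite divr_gt0.
  have [d d0 h] := cf (row_tuple v) _ e2.
  (* One half of the radius pays for moving the cube point, the other for [y]; the factor n + 1
     turns coordinatewise bounds into one on [tdist], also when n = 0. *)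
  pose d1 := d / n.+1%:R / 2.
  have d10 : 0 < d1 by rewrite !divr_gt0.
  exists (ball v d1, [set del | del < d1]); first split.
  - exact: nbhsx_ballx.
  - by apply: nbhs_right_lt.
  move=> [v' del] /= [[_ vv'] dd] y vy.
  have close i : `|v ord0 i - v' ord0 i| < d1 by exact: vv'.
  have K i : distZ (v ord0 i - tnth y i) < d / n.+1%:R.
    apply: le_lt_trans (distZ_lip _ (v' ord0 i - tnth y i)) _.
    rewrite [ltRHS]splitr ltrD//; first exact: lt_trans (vy i) dd.
    by rewrite opprB addrA subrK.
  have h1 : `|f (row_tuple v) - f y| < e / 2.
    by apply: h; apply: tdist_lt_distZ => // i; rewrite tnth_mktuple.
  have h2 : `|f (row_tuple v) - f (row_tuple v')| < e / 2.
    apply: h; apply: tdist_lt_distZ => // i; rewrite !tnth_mktuple.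
    rewrite (le_lt_trans (distZ_le_norm _))// (lt_trans (close i))//.
    by rewrite /d1 ltr_pdivrMr// ltr_pMr ?ltr1n// divr_gt0.
  rewrite (_ : _ - _ = (f (row_tuple v) - f y) - (f (row_tuple v) - f (row_tuple v'))); last by ring.
  by rewrite (le_lt_trans (ler_normB _ _))// [e]splitr ltrD.
move=> d /= d0 H; exists (d / 2); first by rewrite divr_gt0.
move=> v vI; apply: H => //=; last by rewrite divr_gt0.
by rewrite sub0r normrN gtr0_norm ?divr_gt0// ltr_pdivrMr// ltr_pMr// ltr1n.
Qed.

(** Periodicity moves the first point into the compact unit cube. The second stays where it is,
    since [cube_uniform] compares the two modulo 1. *)
Lemma tcont_torus_buc f : torus_periodic f -> tcontinuous f -> torus_buc f.
Proof.
move=> pf cf.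
have row_fpart x : row_tuple (\row_i tnth (fpart x) i) = fpart x.
  by apply/eq_from_tnth => i; rewrite tnth_mktuple mxE.
have ufp x : f x = f (fpart x) by rewrite /fpart pf.
have inI x i : `[(0 : R), 1]%classic ((\row_i tnth (fpart x) i) ord0 i).
  by rewrite /= in_itv/= mxE fpart_itv.
split.
  have /compact_near_coveringP/(_ R +oo (fun M v => `|f (row_tuple v)| <= M) _)
    := cube_compact.
  case.
    move=> v vI; have [d d0 h] := cube_uniform cf (@ltr01 R).
    exists (ball v d, [set M | `|f (row_tuple v)| + 1 <= M]); first split.
    - exact: nbhsx_ballx.
    - by apply: nbhs_pinfty_ge; rewrite num_real.
    move=> [v' M] /= [[_ vv'] MM]; apply: le_trans MM.
    have := h v vI (row_tuple v').
    have K i : distZ (v ord0 i - tnth (row_tuple v') i) < d.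
      by rewrite tnth_mktuple (le_lt_trans (distZ_le_norm _))//; exact: vv'.
    move=> /(_ K) /ltW; rewrite distrC => K'.
    rewrite -(subrK (f (row_tuple v)) (f (row_tuple v'))) addrC.
    by rewrite (le_trans (ler_normD _ _))// lerD2l.
  move=> M /= [_ H]; exists (M + 1) => x; rewrite ufp -row_fpart.
  by apply: H (inI x); rewrite /= ltrDl.
move=> e e0; have [d d0 h] := cube_uniform cf e0.
exists d => // x y xy; rewrite ufp -row_fpart; apply: h; first exact: inI.
by move=> i; rewrite mxE distZ_fpartl.
Qed.

Lemma tdist0 x : tdist x x = 0.
Proof.
rewrite /tdist big1 ?sqrtr0// => i _.
by rewrite subrr distZ0 expr0n.
Qed.

Variable K : n.-tuple R -> n.-tuple R -> R.
Hypotheses (cK : kcontinuous K) (pK : periodic_kernel K) (posK : posdef_kernel K).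

(** Two points with coefficients 1 and -1 give |f x - f y|^2 <= C^2 (K x x - K x y - K y x + K y y).
    The right-hand side vanishes for equivalent points and is small for close ones. *)
Lemma kbound_torus_buc (f : n.-tuple R -> R) (C : R) : kbound K f C -> torus_buc f.
Proof.
move=> fC; apply: tcont_torus_buc.
  move=> x k.
  have := fC 2%N (fun i => if i == ord0 then tshift x k else x)
    (fun i => if i == ord0 then 1 else -1).
  rewrite !big_ord_recl !big_ord0 /= !(pK _ _ _).1 !(pK _ _ _).2.
  rewrite [X in _ <= X](_ : _ = 0); last by ring.
  rewrite real_exprn_even_le0 ?num_real//= addr0 mul1r mulN1r subr_eq0.
  by move/eqP.
move=> x e e0.
pose C1 := `|C| + 1; have C10 : 0 < C1 by rewrite ltr_wpDl.
(* The kernel expression is a signed sum of three differences from K x x, hence below 3/4 of (e /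
   C1)^2. *)
have e1 : 0 < (e / C1) ^+ 2 / 4 by rewrite divr_gt0// exprn_gt0// divr_gt0.
have [d d0 h] := cK x x e1; exists d => // y xy.
have xx : tdist x x < d by rewrite tdist0.
have h1 := h x y xx xy; have h2 := h y y xy xy; have h3 := h y x xy xx.
have := fC 2%N (fun i => if i == ord0 then x else y)
    (fun i => if i == ord0 then 1 else -1).
have := posK (fun i : 'I_2 => if i == ord0 then x else y)
    (fun i => if i == ord0 then 1 else -1).
rewrite !big_ord_recl !big_ord0 /=.
rewrite (_ : 1 * f x + _ = f x - f y); last by ring.
move=> S0 H; rewrite -ltr_sqr ?nnegrE ?(ltW e0)// real_normK ?num_real//.
apply: le_lt_trans H _.
have -> : e ^+ 2 = C1 ^+ 2 * ((e / C1) ^+ 2) by rewrite -exprMn mulrC divfK// gt_eqF.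
move: S0; set S := (X in _ -> _ * X < _) => S0.
have Sle : S < (e / C1) ^+ 2.
  rewrite /S; move: h1 h2 h3 e1; move: ((e / C1) ^+ 2) (K x x) (K x y) (K y x) (K y y).
  move=> E a b c g; rewrite !ltr_norml => /andP[? ?] /andP[? ?] /andP[? ?] ?.
  lra.
have CC : C ^+ 2 <= C1 ^+ 2.
  by rewrite -(real_normK (num_real C)) lerXn2r ?nnegrE ?(ltW C10)// lerDl.
apply: (@le_lt_trans _ _ (C1 ^+ 2 * S)); last by rewrite ltr_pM2l// exprn_gt0.
exact: ler_wpM2r.
Qed.

Lemma kernel_diag_bounded : exists2 B : R, 0 <= B & forall x, K x x <= B ^+ 2.
Proof.
have [[B HB] _] : torus_buc (fun x => K x x).
  apply: tcont_torus_buc; first by move=> x k; rewrite (pK _ _ _).1 (pK _ _ _).2.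
  move=> x e e0; have [d d0 h] := cK x x e0; exists d => // y xy; exact: h.
exists (Num.sqrt `|B|); first exact: sqrtr_ge0.
by move=> x; rewrite sqr_sqrtr// (le_trans (ler_norm _))// (le_trans (HB x))// ler_norm.
Qed.

Lemma kbound_le f (B C : R) : kbound K f C -> (forall x, K x x <= B ^+ 2) ->
  0 <= B -> 0 <= C -> forall x, `|f x| <= C * B.
Proof.
move=> fK KB B0 C0 x; rewrite -ler_sqr ?nnegrE ?mulr_ge0// real_normK ?num_real//.
rewrite exprMn; apply: le_trans (ler_wpM2l (sqr_ge0 C) (KB x)).
have := fK 1%N (fun=> x) (fun=> 1).
by rewrite !big_ord_recl !big_ord0 !addr0 !mul1r.
Qed.

(** [Knorm] is an infimum, so a witness is only extracted strictly above it; the constant 2 leaves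
    this slack. *)
Lemma Knorm_kbound f : (Knorm K f <= 1)%E -> kbound K f 2.
Proof.
move=> f1; have : (Knorm K f < 2%:E)%E by rewrite (le_lt_trans f1)// lte_fin ltr1n.
move=> /ereal_inf_lt[_ /= [C [C0 fC] <-]]; rewrite lte_fin => C2 m x a.
apply: le_trans (fC m x a) _; apply: ler_wpM2r; first exact: posK.
by rewrite lerXn2r ?nnegrE// ltW.
Qed.

End UniformContinuity.

(** * Existence of minimizers *)

Section Minimizer.
Variables (R : realType) (d : nat).

Lemma within01_continuous (h : R -> R) :
  (forall e : R, 0 < e -> exists2 mu : R, 0 < mu & forall t u, t \in `[0, 1] ->
     u \in `[0, 1] -> `|t - u| <= mu -> `|h t - h u| <= e) ->
  {within `[(0 : R), 1], continuous h}.
Proof.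
move=> H; apply/subspace_continuousP => t /= t01; apply/cvgrPdist_le => e e0.
have [mu mu0 hmu] := H e e0.
have tmu : \forall u \near t, `|t - u| <= mu.
  exact: (@cvgr_dist_le _ _ _ _ _ id t (@cvg_id _ (nbhs t)) mu mu0).
by rewrite near_withinE; apply: filterS tmu => u tu u01; exact: hmu.
Qed.

(* A cluster point, in the compact product of the intervals [0, B i], of the filter of
   sublevel sets of D on A. *)
Lemma prod_min (I : eqType) (B : I -> R) (A : set (I -> R)) (D : (I -> R) -> \bar R) :
  A !=set0 -> (forall x, A x -> forall i, 0 <= x i <= B i) ->
  exists2 x : I -> R, (forall i, 0 <= x i <= B i) &
    forall y, A y -> forall (J : finType) (c : J -> I) (eta : R), 0 < eta ->
      exists z, [/\ A z, (D z <= D y)%E & forall j, `|x (c j) - z (c j)| < eta].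
Proof.
move=> A0 AB.
pose T := prod_topology (fun _ : I => R).
have cB : compact [set f : T | forall i, `[0, B i]%classic (f i)].
  apply: (@tychonoff I (fun=> R) (fun i => `[0, B i]%classic)) => i.
  exact: segment_compact.
pose F : set_system T := filter_from A (fun y => [set z | A z /\ (D z <= D y)%E]).
have FF : Filter F.
  apply: filter_from_filter => // y y' Ay Ay'.
  have [h|h] := leP (D y) (D y').
    by exists y => // z [Az zy]; split; split => //; exact: (le_trans zy h).
  by exists y' => // z [Az zy]; split; split => //; exact: (le_trans zy (ltW h)).
have PF : ProperFilter F.
  by apply: filter_from_proper => y Ay; exists y.
have FB : F [set f : T | forall i, `[0, B i]%classic (f i)].
  by have [y Ay] := A0; exists y => // z [Az _] i /=; rewrite in_itv/= AB.
have [x [xB clx]] := cB F PF FB.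
exists x; first by move=> i; have := xB i; rewrite /= in_itv.
move=> y Ay J c eta eta0.
have Fy : F [set z | A z /\ (D z <= D y)%E] by exists y.
have Nx : nbhs x [set z : T | forall j, `|x (c j) - z (c j)| < eta].
  apply: (@filter_forall T J (fun j z => `|x (c j) - z (c j)| < eta) (nbhs x)) => j.
  have P : (fun z : T => z (c j)) @ nbhs x --> (x (c j) : R).
    exact: (@proj_continuous I (fun=> (R : topologicalType)) (c j) x).
  exact: (@cvgr_dist_lt R R T (nbhs x) _ (fun z : T => z (c j)) (x (c j)) P eta eta0).
by have [z [[Az zy] zx]] := clx _ _ Fy Nx; exists z.
Qed.

(** The part of the constraints that yields equicontinuity; closedness and total mass one are
    recovered separately for the limit. The upper bound on the weight comes from [lip_weight_le]. *)
Definition admissible (L l : R) (g : R -> d.-tuple R) (r : R -> R) : Prop :=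
  [/\ forall t t', t \in `[0, 1] -> t' \in `[0, 1] -> tdist (g t) (g t') <= L * `|t - t'|,
      forall t t', t \in `[0, 1] -> t' \in `[0, 1] -> `|r t - r t'| <= l * `|t - t'| &
      forall t, t \in `[0, 1] -> 0 <= r t <= 1 + l].

(** The same [mu] works for all admissible pairs, both for changing the time and for changing the
    curve at a fixed time; this uniformity allows integrals to be compared from finitely many
    samples. *)
Lemma admissible_modulus (L l e : R) (phi : d.-tuple R -> R) : 0 <= L -> 0 <= l ->
  torus_buc phi -> 0 < e -> exists2 mu : R, 0 < mu &
    forall g r, admissible L l g r ->
      (forall t u, t \in `[0, 1] -> u \in `[0, 1] -> `|t - u| <= mu ->
         `|phi (g t) * r t - phi (g u) * r u| <= e) /\
      (forall g' r' t, admissible L l g' r' -> t \in `[0, 1] ->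
         (forall i, `|tnth (g t) i - tnth (g' t) i| < mu) -> `|r t - r' t| < mu ->
         `|phi (g t) * r t - phi (g' t) * r' t| <= e).
Proof.
move=> L0 l0 [[B phiB] uphi] e0.
have B0 : 0 <= B by apply: le_trans (phiB [tuple 0 | i < d]).
pose e' := e / 2 / (1 + l); have l1 : 0 < 1 + l by rewrite ltr_pwDl.
have e'0 : 0 < e' by rewrite !divr_gt0.
have [del del0 hdel] := uphi _ e'0.
have D0 : 0 < L + l + 1 by rewrite ltr_wpDl// addr_ge0.
have B1 : 0 < B + 1 by rewrite ltr_wpDl.
pose k := Num.min del (e / 2 / (B + 1)).
have k0 : 0 < k by rewrite lt_min del0 !divr_gt0.
pose mu := k / (L + l + 1).
have mu0 : 0 < mu by rewrite divr_gt0.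
have muE : mu * (L + l + 1) = k by rewrite divfK// gt_eqF.
have kdel : k <= del by rewrite ge_min lexx.
have kB : B * k <= e / 2.
  apply: (@le_trans _ _ ((B + 1) * k)); first by rewrite ler_wpM2r ?(ltW k0)// lerDl.
  by rewrite mulrC -ler_pdivlMr// ge_min lexx orbT.
have muk : mu <= k by rewrite -muE; nra.
have Lmu : L * mu < k by rewrite -muE; nra.
have lmu : l * mu <= k by rewrite -muE; nra.
have key p p' (a a' : R) : (forall i, distZ (tnth p i - tnth p' i) < del) ->
    0 <= a <= 1 + l -> `|a - a'| <= k -> `|phi p * a - phi p' * a'| <= e.
  move=> pp' /andP[a0 al] aa'.
  have -> : phi p * a - phi p' * a' = (phi p - phi p') * a + phi p' * (a - a') by ring.
  rewrite (le_trans (ler_normD _ _))// [e]splitr !normrM lerD//.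
    apply: (@le_trans _ _ (e' * (1 + l))); last by rewrite /e' divfK// gt_eqF.
    by apply: ler_pM => //; [exact/ltW/hdel|rewrite ger0_norm].
  by apply: le_trans kB; rewrite ler_pM.
exists mu => // g r [gL rl rb]; split.
  move=> t u t01 u01 tu; apply: key; last 2 first.
  - exact: rb.
  - by apply: le_trans lmu; apply: le_trans (rl _ _ t01 u01) _; exact: ler_wpM2l.
  move=> i; apply: le_lt_trans (distZ_le_tdist _ _ i) _.
  apply: le_lt_trans (gL _ _ t01 u01) _; apply: lt_le_trans kdel.
  by apply: le_lt_trans Lmu; exact: ler_wpM2l.
move=> g' r' t _ t01 gg' rr'; apply: key; last 2 first.
- exact: rb.
- by rewrite (le_trans (ltW rr')).
move=> i; rewrite (le_lt_trans (distZ_le_norm _))// (lt_le_trans (gg' i))//.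
exact: le_trans kdel.
Qed.

Lemma admissible_continuous (L l : R) (phi : d.-tuple R -> R) g r : 0 <= L -> 0 <= l ->
  torus_buc phi -> admissible L l g r -> {within `[(0 : R), 1], continuous (fun t => phi (g t) * r t)}.
Proof.
move=> L0 l0 tphi ag; apply: within01_continuous => e e0.
have [mu mu0 h] := admissible_modulus L0 l0 tphi e0.
by exists mu => // t u t01 u01 tu; apply: (h g r ag).1.
Qed.

Lemma grid_near (mu : R) : 0 < mu -> exists M : nat, forall t : R, t \in `[0, 1] ->
  exists j : 'I_M.+2, (j%:R / M.+1%:R : R) \in `[0, 1] /\ `|t - j%:R / M.+1%:R| <= mu.
Proof.
move=> mu0; pose M := Num.truncn mu^-1; exists M => t; rewrite in_itv/= => /andP[t0 t1].
have M0 : 0 < M.+1%:R :> R by [].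
have tM0 : 0 <= t * M.+1%:R by rewrite mulr_ge0.
have /andP[j1 j2] := truncn_itv tM0.
have jM : (Num.truncn (t * M.+1%:R) < M.+2)%N.
  rewrite ltnS -(ler_nat R); apply: le_trans j1 _.
  by rewrite ler_piMl.
exists (Ordinal jM) => /=; rewrite in_itv/=; split.
  rewrite divr_ge0//= ler_pdivrMr// mul1r.
  by apply: le_trans j1 _; rewrite ler_piMl.
rewrite ger0_norm ?subr_ge0 ?ler_pdivrMr//.
have h : M.+1%:R^-1 <= mu.
  rewrite -[mu]invrK lef_pV2 ?posrE ?invr_gt0//.
  by apply/ltW/truncnS_gt.
apply: le_trans h; rewrite lerBlDr.
rewrite (_ : _ + _ = (1 + (Num.truncn (t * M.+1%:R))%:R) / M.+1%:R).
  by rewrite ler_pdivlMr// addrC natr1 ltW.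
by rewrite mulrDl mul1r.
Qed.

(* A point x of the product space R^coord encodes a curve (coordinates [Some i]) with a
   weight (coordinate [None]), as functions of time. *)
Definition coord : Type := (R * option 'I_d)%type.
Definition curve_of (x : coord -> R) (t : R) : d.-tuple R := [tuple x (t, Some i) | i < d].
Definition weight_of (x : coord -> R) (t : R) : R := x (t, None).

(** Continuity of the integral functional for the product topology: the coordinates [c] sample a
    finite grid of times, and equicontinuity covers the times in between at the price of two further
    e / 3. *)
Lemma admissible_close (L l e : R) (phi : d.-tuple R -> R) : 0 <= L -> 0 <= l ->
  torus_buc phi -> 0 < e -> exists (J : finType) (c : J -> coord) (eta : R), 0 < eta /\
    forall x z, admissible L l (curve_of x) (weight_of x) -> admissible L l (curve_of z) (weight_of z) ->
      (forall j, `|x (c j) - z (c j)| < eta) ->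
      `|int01 (fun t => phi (curve_of x t) * weight_of x t) - int01 (fun t => phi (curve_of z t) * weight_of z t)| <= e.
Proof.
move=> L0 l0 tphi e0; have e3 : 0 < e / 3 by rewrite divr_gt0.
have [mu mu0 h] := admissible_modulus L0 l0 tphi e3.
have [M hM] := grid_near mu0.
exists ('I_M.+2 * option 'I_d)%type, 
  (fun p : 'I_M.+2 * option 'I_d => ((p.1 : nat)%:R / M.+1%:R : R, p.2)), mu.
split => // x z ax az xz; apply: int01_dist; try exact: (@admissible_continuous L l).
move=> t t01; have [j [j01 tj]] := hM t t01.
have h1 := (h _ _ ax).1 _ _ t01 j01 tj.
have h2 := (h _ _ az).1 _ _ t01 j01 tj.
have h3 : `|phi (curve_of x (j%:R / M.+1%:R)) * weight_of x (j%:R / M.+1%:R) -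
     phi (curve_of z (j%:R / M.+1%:R)) * weight_of z (j%:R / M.+1%:R)| <= e / 3.
  apply: (h _ _ ax).2 => //; last exact: (xz (j, None)).
  by move=> i; rewrite !tnth_mktuple; exact: (xz (j, Some i)).
move: h1 h2 h3; rewrite !ler_norml => /andP[? ?] /andP[? ?] /andP[? ?].
by apply/andP; split; lra.
Qed.

(** On an interval of length one, r t - l is a lower bound for r; integrating gives r t - l <= 1. *)
Lemma lip_weight_le (l : R) (r : R -> R) : 0 <= l -> lip_weight l r ->
  forall t, t \in `[0, 1] -> 0 <= r t <= 1 + l.
Proof.
move=> l0 [r0 r1 rl] t t01; rewrite r0//=.
have cr : {within `[(0 : R), 1], continuous r}.
  apply: within01_continuous => e e0; exists (e / (l + 1)); first by rewrite divr_gt0// ltr_wpDl.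
  move=> u v u01 v01 uv; apply: le_trans (rl _ _ u01 v01) _.
  apply: le_trans (ler_wpM2l l0 uv) _.
  by rewrite mulrA ler_pdivrMr ?ltr_wpDl// mulrC ler_wpM2l ?(ltW e0)// lerDl.
have I1 : int01 r = 1.
  by have := int01E cr; rewrite r1 => -[<-].
rewrite -lerBlDr -I1 -(int01_cst (r t - l)).
apply: le_int01 => //; first exact: within_cst.
move=> u u01; have := rl _ _ t01 u01; rewrite ler_distl => /andP[_ h].
rewrite lerBlDr; apply: le_trans h _; rewrite lerD2l ler_piMr//.
move: t01 u01; rewrite !in_itv/= => /andP[? ?] /andP[? ?].
by rewrite ler_distl; apply/andP; split; lra.
Qed.

Lemma lip_adm (L l : R) g r : 0 <= l -> lip_closed_curve L g -> lip_weight l r -> admissible L l g r.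
Proof.
move=> l0 [_ gL] rl; have := lip_weight_le l0 rl; case: rl => _ _ rl.
by split.
Qed.

Lemma torus_buc_cst (c : R) : torus_buc (fun _ : d.-tuple R => c).
Proof.
split; first by exists `|c|.
by move=> e e0; exists 1 => // x y _; rewrite subrr normr0.
Qed.

(** A coordinate distance b <= 1/2 grows by at most 2 eta, and (b + 2 eta)^2 - b^2 = 4 b eta + 4
    eta^2 is below 8 eta. *)
Lemma tdist_sqr_close (p p' q q' : d.-tuple R) (eta : R) : 0 < eta -> eta <= 1 ->
  (forall i, `|tnth p i - tnth q i| < eta) -> (forall i, `|tnth p' i - tnth q' i| < eta) ->
  tdist p p' ^+ 2 <= tdist q q' ^+ 2 + d%:R * (8 * eta).
Proof.
move=> eta0 eta1 pq pq'.
have sq0 (a b : d.-tuple R) : 0 <= \sum_(i < d) distZ (tnth a i - tnth b i) ^+ 2.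
  by apply: sumr_ge0 => i _; exact: sqr_ge0.
rewrite !sqr_sqrtr//.
have -> : d%:R * (8 * eta) = \sum_(i < d) 8 * eta.
  by rewrite sumr_const card_ord [LHS]mulr_natl.
rewrite -big_split/=; apply: ler_sum => i _.
have h0 := distZ_ge0 (tnth p i - tnth p' i).
have h1 := distZ_half (tnth q i - tnth q' i).
have h2 := distZ_ge0 (tnth q i - tnth q' i).
have := distZ_lip (tnth p i - tnth p' i) (tnth q i - tnth q' i).
have : `|tnth p i - tnth p' i - (tnth q i - tnth q' i)| <= 2 * eta.
  have -> : tnth p i - tnth p' i - (tnth q i - tnth q' i) =
    (tnth p i - tnth q i) - (tnth p' i - tnth q' i) by ring.
  rewrite (le_trans (ler_normB _ _))//.
  by rewrite mulr_natl mulr2n lerD// ltW.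
move: h0 h1 h2; 
move: (distZ (tnth p i - tnth p' i)) (distZ (tnth q i - tnth q' i)) => a b a0 b1 b0 n2 n1.
have ab : a <= b + 2 * eta by rewrite (le_trans n1)// lerD2l.
have : a ^+ 2 <= (b + 2 * eta) ^+ 2 by rewrite lerXn2r ?nnegrE// (le_trans a0).
nra.
Qed.

Variable Phi : set (d.-tuple R -> R).
Hypothesis tPhi : forall phi, Phi phi -> torus_buc phi.
Hypothesis pPhi : forall phi, Phi phi -> torus_periodic phi.
Variable a : (d.-tuple R -> R) -> R.

Definition disc (g : R -> d.-tuple R) (r : R -> R) : \bar R :=
  ereal_sup [set (`|a phi - int01 (fun t => phi (g t) * r t)|)%:E | phi in Phi].

(** The point given by [prod_min] is approximated by competitors on finitely many coordinates at a
    time. That is enough, since each Lipschitz inequality and the closing condition involve two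
    times, while the total mass and each integral of phi depend on finitely many coordinates up to
    e. *)
Lemma exists_minimizer (L l : R) : 0 <= L -> 0 <= l -> exists g r,
  [/\ lip_closed_curve L g, lip_weight l r &
      forall g' r', lip_closed_curve L g' -> lip_weight l r' ->
        (disc g r <= disc g' r')%E].
Proof.
move=> L0 l0.
pose B (i : coord) : R := if i.2 is Some _ then 1 else 1 + l.
pose A : set (coord -> R) := [set x | [/\ forall i, 0 <= x i <= B i,
  lip_closed_curve L (curve_of x) & lip_weight l (weight_of x)]].
have A0 : A !=set0.
  exists (fun i => if i.2 is Some _ then 0 else 1); split.
  - by case=> t [i|]/=; rewrite ?lexx ?ler01//= lerDl.
  - have E t t' : tdist (curve_of (fun i : coord => if i.2 is Some _ then 0 else 1) t)
      (curve_of (fun i : coord => if i.2 is Some _ then 0 else 1) t') = 0 by exact: tdist0.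
    by split; [exact: E|move=> t t' _ _; rewrite E mulr_ge0].
  - split => //; last by move=> t t' _ _; rewrite subrr normr0 mulr_ge0.
    by have := int01E (@within_cst R `[0, 1]%classic 1); rewrite int01_cst.
have AB x : A x -> forall i, 0 <= x i <= B i by case.
have [x xB hx] := @prod_min _ B A (fun x => disc (curve_of x) (weight_of x)) A0 AB.
have close (J : finType) (c : J -> coord) eta : 0 < eta ->
    exists2 z, A z & forall j, `|x (c j) - z (c j)| < eta.
  by move=> eta0; have [y Ay] := A0; have [z [Az _ zx]] := hx y Ay J c eta eta0; exists z.
have distL t t' (C : R) : 0 <= C ->
    (forall z, A z -> tdist (curve_of z t) (curve_of z t') <= C) -> tdist (curve_of x t) (curve_of x t') <= C.
  move=> C0 hz; rewrite -ler_sqr ?nnegrE ?sqrtr_ge0//; apply/ler_addgt0Pr => e e0.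
  pose eta := Num.min 1 (e / (d%:R * 8 + 1)).
  have D0 : 0 < d%:R * 8 + 1 :> R by rewrite ltr_wpDl// mulr_ge0.
  have eta0 : 0 < eta by rewrite lt_min ltr01 divr_gt0.
  have eta1 : eta <= 1 by rewrite ge_min lexx.
  have etae : d%:R * (8 * eta) <= e.
    apply: (@le_trans _ _ ((d%:R * 8 + 1) * eta)).
      by rewrite mulrA ler_wpM2r ?(ltW eta0)// lerDl.
    by rewrite mulrC -ler_pdivlMr// ge_min lexx orbT.
  have [z Az zx] := close _ (fun p : bool * 'I_d => (if p.1 then t else t', Some p.2)) _ eta0.
  apply: (@le_trans _ _ (tdist (curve_of z t) (curve_of z t') ^+ 2 + d%:R * (8 * eta))).
    apply: tdist_sqr_close => // i; rewrite !tnth_mktuple.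
      exact: (zx (true, i)).
    exact: (zx (false, i)).
  by rewrite lerD// lerXn2r ?nnegrE ?sqrtr_ge0 ?hz.
have gL t t' : t \in `[0, 1] -> t' \in `[0, 1] -> tdist (curve_of x t) (curve_of x t') <= L * `|t - t'|.
  move=> t01 t'01; apply: distL; first exact: mulr_ge0.
  by move=> z [_ [_ zL] _]; exact: zL.
have rl t t' : t \in `[0, 1] -> t' \in `[0, 1] -> `|weight_of x t - weight_of x t'| <= l * `|t - t'|.
  move=> t01 t'01; apply/ler_addgt0Pr => e e0.
  have e2 : 0 < e / 2 by rewrite divr_gt0.
  have [z [_ _ [_ _ zl]] zx] := close _ (fun b : bool => (if b then t else t', None)) _ e2.
  have := zl _ _ t01 t'01; have := zx true; have := zx false.
  rewrite /weight_of /= !ltr_distl !ler_distl => /andP[? ?] /andP[? ?] /andP[? ?].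
  by apply/andP; split; lra.
have ax : admissible L l (curve_of x) (weight_of x).
  by split => // t t01; exact: (xB (t, None)).
have closed_x : lip_closed_curve L (curve_of x).
  split => //; apply/eqP; rewrite eq_le sqrtr_ge0 andbT.
  by apply: distL => // z [_ [-> _] _].
have crx : {within `[(0 : R), 1], continuous (weight_of x)}.
  have := admissible_continuous L0 l0 (torus_buc_cst 1) ax; congr {within _, continuous _}.
  by apply/funext => t; exact: mul1r.
have weight_x : lip_weight l (weight_of x).
  split => //; first by move=> t _; have /andP[] := xB (t, None).
  rewrite int01E//; congr EFin; apply/eqP; rewrite -subr_eq0 -normr_eq0 eq_le normr_ge0 andbT.
  apply/ler_addgt0Pr => e e0; rewrite add0r.
  have [J [c [eta [eta0 h]]]] := admissible_close L0 l0 (torus_buc_cst 1) e0.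
  have [z [_ zc zw] zx] := close J c _ eta0.
  have az : admissible L l (curve_of z) (weight_of z) by exact: lip_adm.
  have := h x z ax az zx.
  have -> : int01 (fun t => 1 * weight_of x t) = int01 (weight_of x) by congr int01; apply/funext => t; rewrite mul1r.
  suff -> : int01 (fun t => 1 * weight_of z t) = 1 by [].
  have cz := admissible_continuous L0 l0 (torus_buc_cst 1) az.
  have /= E := int01E cz; apply: EFin_inj; rewrite -E; case: zw => _ <- _.
  by apply: eq_integral => t _; rewrite mul1r.
exists (curve_of x), (weight_of x); split => // g' r' cg' wg'.
(* An arbitrary competitor is moved into the compact box: the curve is reduced modulo 1, which
   neither [tdist] nor periodic functions notice, and the weight is cut off outside [0, 1]. *)
pose y (i : coord) : R := match i.2 with Some k => tnth (fpart (g' i.1)) k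
  | None => if i.1 \in `[0, 1] then r' i.1 else 0 end.
have gy t : curve_of y t = fpart (g' t) by apply/eq_from_tnth => i; rewrite tnth_mktuple.
have ry t : t \in `[0, 1] -> weight_of y t = r' t by move=> t01; rewrite /weight_of /y/= t01.
have Ay : A y.
  split.
  - case=> t [i|]; rewrite /B /y/=; first exact: fpart_itv.
    case: ifP => [/(lip_weight_le l0 wg')//|_]; rewrite lexx/= addr_ge0//.
  - case: cg' => c1 c2; split; first by rewrite !gy tdist_fpart.
    by move=> t t' t01 t'01; rewrite !gy tdist_fpart c2.
  - case: wg' => w1 w2 w3; split.
    + by move=> t t01; rewrite ry// w1.
    + by rewrite -w2; apply: eq_integral => t; rewrite inE/= => t01; rewrite ry.
    + by move=> t t' t01 t'01; rewrite !ry// w3.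
have -> : disc g' r' = disc (curve_of y) (weight_of y).
  congr ereal_sup; apply: eq_imagel => phi Pphi; congr (`|a phi - _|%:E).
  by apply: eq_int01 => t t01; rewrite ry// gy /fpart (pPhi Pphi).
apply: ge_ereal_sup => _ [phi Pphi <-]; apply/lee_addgt0Pr => e e0.
have [J [c [eta [eta0 h]]]] := admissible_close L0 l0 (tPhi Pphi) e0.
have [z [Az zy zx]] := hx y Ay J c eta eta0.
have az : admissible L l (curve_of z) (weight_of z) by case: Az => _ ? ?; exact: lip_adm.
have H := h x z ax az zx.
apply: (@le_trans _ _ (disc (curve_of z) (weight_of z) + e%:E)%E); last exact: leeD2r.
apply: (@le_trans _ _ ((`|a phi - int01 (fun t => phi (curve_of z t) * weight_of z t)|)%:E + e%:E)%E).
  rewrite -EFinD lee_fin.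
  move: H; set u := int01 _; set v := int01 _ => uv.
  rewrite (_ : a phi - u = (a phi - v) - (u - v)); last by ring.
  by rewrite (le_trans (ler_normB _ _))// lerD2l.
by apply: leeD2r; apply: ereal_sup_ubound; exists phi.
Qed.

End Minimizer.

(** * Reparametrization of a weighted curve *)

Section Reparametrization.
Variable R : realType.

Lemma int01_FTC (p H : R -> R) : continuous p ->
  (forall x : R, x \in `]-1, 2[ -> is_derive x (1 : R) H (p x)) -> int01 p = H 1 - H 0.
Proof.
move=> cp dH.
have cH (x : R) : x \in `](-1 : R), 2[ -> {for x, continuous H}.
  move=> x12; apply/differentiable_continuous/derivable1_diffP.
  exact: (@ex_derive _ _ _ _ _ _ _ (dH x x12)).
have sub (x : R) : x \in `](0 : R), 1[ -> x \in `](-1 : R), 2[.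
  by rewrite !in_itv/= => /andP[? ?]; apply/andP; split; lra.
rewrite /int01 /Rintegral (@continuous_FTC2 _ p H)//.
- exact: continuous_subspaceT.
- split.
  + by move=> x /sub x12; exact: (@ex_derive _ _ _ _ _ _ _ (dH x x12)).
  + by apply/cvg_at_right_filter/cH; rewrite in_itv/=; apply/andP; split; lra.
  + by apply/cvg_at_left_filter/cH; rewrite in_itv/=; apply/andP; split; lra.
- by move=> x /sub x12; rewrite derive1E; exact: (@derive_val _ _ _ _ _ _ _ (dH x x12)).
Qed.

(** Integrating on [-1, 2] makes 0 and 1 interior points, so that two-sided derivatives exist
    there. *)
Lemma primitive_near01 (p : R -> R) : continuous p -> exists H : R -> R,
  H 0 = 0 /\ forall x : R, x \in `]-1, 2[ -> is_derive x (1 : R) H (p x).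
Proof.
move=> cp.
pose F x : R := \int[@lebesgue_measure R]_(t in `[-1, x]) p t.
have ip : (@lebesgue_measure R).-integrable `[-1, 2] (EFin \o p).
  apply: continuous_compact_integrable; first exact: segment_compact.
  exact: continuous_subspaceT.
exists (fun x => F x - F 0); split; first by rewrite subrr.
move=> x; rewrite in_itv/= => /andP[x1 x2].
have [dF F'] := @continuous_FTC1_closed R p (-1) x 2 x2 ip x1 (cp x).
have dFx : is_derive x (1 : R) F (p x).
  by rewrite -F' derive1E; exact: (derivableP dF).
have := @is_deriveB _ _ _ F (cst (F 0)) x 1 (p x) 0 dFx (is_derive_cst _ _ _).
by rewrite subr0.
Qed.

(** [tau] inverts the primitive H of p. As p >= m, the function H increases with slope at least m,
    so the inverse is Lipschitz with constant 1 / m; the integral formula is the substitution u = H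
    t. *)
Lemma reparametrize (p : R -> R) (m : R) : continuous p -> 0 < m ->
  (forall t, m <= p t) -> int01 p = 1 -> exists tau : R -> R,
  [/\ tau 0 = 0, tau 1 = 1,
      forall u, u \in `[0, 1] -> tau u \in `[0, 1],
      forall u v, u \in `[0, 1] -> v \in `[0, 1] -> m * `|tau u - tau v| <= `|u - v| &
      forall psi : R -> R, {within `[(0 : R), 1], continuous (psi \o tau)} ->
        int01 (psi \o tau) = int01 (fun t => psi t * p t)].
Proof.
move=> cp m0 mp p1; have [H [H0 dH]] := primitive_near01 cp.
have H1 : H 1 = 1 by have := int01_FTC cp dH; rewrite p1 H0 subr0.
have sub (x : R) : x \in `[(0 : R), 1] -> x \in `](-1 : R), 2[.
  by rewrite !in_itv/= => /andP[? ?]; apply/andP; split; lra.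
have cH (x : R) : x \in `](-1 : R), 2[ -> {for x, continuous H}.
  move=> x12; apply/differentiable_continuous/derivable1_diffP.
  exact: (@ex_derive _ _ _ _ _ _ _ (dH x x12)).
have cHw (a b : R) : 0 <= a -> b <= 1 -> {within `[a, b], continuous H}.
  move=> a0 b1; apply: continuous_in_subspaceT => x; rewrite inE/= in_itv/= => /andP[ax xb].
  by apply/cH/sub; rewrite in_itv/= (le_trans a0)// (le_trans xb).
have mono u v : 0 <= u -> u <= v -> v <= 1 -> m * (v - u) <= H v - H u.
  move=> u0 uv v1.
  have dHuv x : x \in `]u, v[ -> is_derive x (1 : R) H (p x).
    rewrite in_itv/= => /andP[ux xv]; apply/dH/sub; rewrite in_itv/=.
    by apply/andP; split; lra.
  have [c _ ->] := @MVT_segment R H p u v uv dHuv (cHw u v u0 v1).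
  by rewrite ler_wpM2r// subr_ge0.
have dist u v : u \in `[0, 1] -> v \in `[0, 1] -> m * `|u - v| <= `|H u - H v|.
  rewrite !in_itv/= => /andP[u0 u1] /andP[v0 v1].
  have [uv|/ltW vu] := leP u v.
    rewrite distrC [leRHS]distrC ger0_norm ?subr_ge0//.
    by rewrite (le_trans (mono u v u0 uv v1))// ler_norm.
  rewrite ger0_norm ?subr_ge0//.
  by rewrite (le_trans (mono v u v0 vu u1))// ler_norm.
have inj u v : u \in `[0, 1] -> v \in `[0, 1] -> H u = H v -> u = v.
  move=> u01 v01 E; have := dist u v u01 v01; rewrite E subrr normr0 pmulr_rle0//.
  by rewrite normr_le0 subr_eq0 => /eqP.
pose P u := [set t | t \in `[(0 : R), 1] /\ H t = u].
(* The default 0 is taken only if u has no preimage in [0, 1]; for u in [0, 1] the intermediate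
   value theorem supplies one. *)
pose tau u := xget 0 (P u).
have tauP u : u \in `[0, 1] -> P u (tau u).
  move=> u01; apply: xgetPex.
  have [|t t01 Ht] := @IVT R H 0 1 u ler01 (cHw 0 1 (lexx _) (lexx _)).
    by move: u01; rewrite in_itv/= H0 H1 minElt maxElt ltr01.
  by exists t.
have i0 : (0 : R) \in `[(0 : R), 1] by rewrite in_itv/= lexx ler01.
have i1 : (1 : R) \in `[(0 : R), 1] by rewrite in_itv/= lexx ler01.
have tauH t : t \in `[0, 1] -> tau (H t) = t.
  move=> t01; have Ht : H t \in `[0, 1].
    move: t01; rewrite !in_itv/= => /andP[t0 t1].
    have h1 := mono 0 t (lexx _) t0 t1; have h2 := mono t 1 t0 t1 (lexx _).
    rewrite H0 H1 in h1 h2.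
    have : 0 <= m * (t - 0) by rewrite mulr_ge0 ?subr_ge0// ltW.
    have : 0 <= m * (1 - t) by rewrite mulr_ge0 ?subr_ge0// ltW.
    by move=> ? ?; apply/andP; split; lra.
  by have [? ?] := tauP _ Ht; apply: inj.
exists tau; split.
- by rewrite -{1}H0 tauH.
- by rewrite -{1}H1 tauH.
- by move=> u /tauP[].
- move=> u v /tauP[tu Hu] /tauP[tv Hv].
  by rewrite -{2}Hu -{2}Hv dist.
move=> psi cpsi.
have incr : {in `[(0 : R), 1] &, {homo H : x y / x < y}}.
  move=> x y; rewrite !in_itv/= => /andP[x0 x1] /andP[y0 y1] xy.
  rewrite -subr_gt0; apply: lt_le_trans (mono x y x0 (ltW xy) y1).
  by rewrite mulr_gt0// subr_gt0.
have H'E x : x \in `](-1 : R), 2[ -> derive1 H x = p x.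
  by move=> x12; rewrite derive1E; exact: (@derive_val _ _ _ _ _ _ _ (dH x x12)).
have cH' x : x \in `](-1 : R), 2[ -> derive1 H y @[y --> x] --> p x.
  move=> x12; apply: cvg_trans (cp x); apply: near_eq_cvg.
  by near=> y; rewrite H'E//; near: y; exact: near_in_itvoo.
have sub' (x : R) : x \in `](0 : R), 1[ -> x \in `](-1 : R), 2[.
  by move=> x01; apply/sub/subset_itv_oo_cc.
have C1 : {in `](0 : R), 1[, continuous (derive1 H)}.
  by move=> x /sub' x12; rewrite /continuous_at H'E//; exact: cH'.
have C2 : cvg (derive1 H x @[x --> (0 : R)^'+]).
  by apply/cvg_ex; exists (p 0); apply/cvg_at_right_filter/cH'/sub.
have C3 : cvg (derive1 H x @[x --> (1 : R)^'-]).
  by apply/cvg_ex; exists (p 1); apply/cvg_at_left_filter/cH'/sub.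
have C4 : derivable_oo_LRcontinuous H 0 1.
  split.
  - by move=> x /sub' x12; exact: (@ex_derive _ _ _ _ _ _ _ (dH x x12)).
  - exact/cvg_at_right_filter/cH/sub.
  - exact/cvg_at_left_filter/cH/sub.
have cpsi' : {within `[H 0, H 1], continuous (psi \o tau)} by rewrite H0 H1.
have E := integration_by_substitution_increasing ler01 incr C1 C2 C3 C4 cpsi'.
rewrite H0 H1 in E; rewrite /int01 /Rintegral E.
congr fine; apply: eq_integral => t; rewrite inE/= => t01.
rewrite -[LHS]/((psi (tau (H t)) * derive1 H t)%:E).
by rewrite tauH// H'E//; exact: sub.
Unshelve. all: by end_near. Qed.

End Reparametrization.

(** * Quadrature along a reparametrized line *)

Section SobolevCoefficients.
Variables (R : realType) (n : nat).
Implicit Types (f : n.-tuple R -> R).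

Lemma fhat2E f (k : n.-tuple int) : torus_buc f ->
  fhat2 f k = (rcos f k ^+ 2 + rsin f k ^+ 2)%:E.
Proof.
move=> /torus_buc_buc bf; rewrite /fhat2 /fcos /fsin.
rewrite !tint_rint; [|exact: buc_mul bf (buc_sink R k)|exact: buc_mul bf (buc_cosk R k)].
by rewrite -!EFinM -EFinD -!expr2.
Qed.

Lemma in_Hs_hsb (s : R) f : torus_buc f -> in_Hs s f -> hsb s f (hs_norm s f).
Proof.
move=> tf [_ _ _ fin] r ur.
have ge0 : (0 <= hs_norm2 s f)%E.
  apply: esum_ge0 => k _; rewrite fhat2E// -EFinM lee_fin mulr_ge0 ?powR_ge0//.
  by rewrite addr_ge0// sqr_ge0.
rewrite /hs_norm sqr_sqrtr ?fine_ge0// -lee_fin fineK ?ge0_fin_numE//.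
apply: esum_ge; exists [set` r]; first by split => //; exact: finite_seq.
rewrite -fsbig_seq// -sumEFin; apply: lee_sum => k _.
by rewrite fhat2E// -EFinM lexx.
Qed.

Lemma hsb_le (s : R) f (A B : R) : 0 <= A -> A <= B -> hsb s f A -> hsb s f B.
Proof.
move=> A0 AB fA r ur; apply: le_trans (fA r ur) _.
by apply: lerXn2r => //; rewrite nnegrE; exact: le_trans AB.
Qed.

Lemma hsb_one (s : R) : hsb s (fun _ : n.-tuple R => 1) 1.
Proof.
move=> r ur; rewrite expr1n.
have -> : \sum_(k <- r) bessel R k `^ s * (rcos (fun=> 1) k ^+ 2 + rsin (fun=> 1) k ^+ 2) =
    \sum_(k <- r) (k == zero_freq n)%:R.
  apply: eq_bigr => k _; rewrite /rcos /rsin.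
  have [c0 s0] := rint_trig R k.
  have -> : (fun y : n.-tuple R => 1 * cos (2 * pi * kdot k y)) =
     (fun y => cos (2 * pi * kdot k y)) by apply/funext => y; rewrite mul1r.
  have -> : (fun y : n.-tuple R => 1 * sin (2 * pi * kdot k y)) =
     (fun y => sin (2 * pi * kdot k y)) by apply/funext => y; rewrite mul1r.
  rewrite c0 s0 expr0n addr0; have [->|_] := eqVneq k (zero_freq n); last by rewrite expr0n mulr0.
  rewrite expr1n mulr1 /bessel /knorm2 big1 ?mulr0 ?addr0 ?powR1// => i _.
  by rewrite tnth_mktuple expr0n.
rewrite -natr_sum -[X in _ <= X]/(1%:R) ler_nat.
have -> : (\sum_(k <- r) (k == zero_freq n) = count_mem (zero_freq n) r)%N.
  by rewrite -sum1_count [RHS]big_mkcond; apply: eq_bigr => k _ /=; case: eqP.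
by rewrite (count_uniq_mem _ ur) leq_b1.
Qed.

End SobolevCoefficients.

Section Quadrature.
Variables (R : realType) (n : nat) (s : R) (rho : n.-tuple R -> R) (Ar Af Bf Z m M : R).
Hypotheses (s0 : 0 <= s) (Ar0 : 0 <= Ar) (Af0 : 0 <= Af) (Z0 : 0 <= Z).
Hypotheses (trho : torus_buc rho) (rho1 : rint rho = 1) (hrho : hsb s rho Ar).
Hypotheses (m0 : 0 < m) (mrho : forall x, m <= rho x) (rhoM : forall x, rho x <= M).
Hypothesis sumZ : forall r : seq (n.-tuple int), uniq r ->
  \sum_(k <- r) (bessel R k `^ s)^-1 <= Z ^+ 2.

(** The coefficient of S in the final error: [bilC] for phi * rho, plus the sup bound [Bf] times
    [bilC] for rho * 1. *)
Definition quadC : R :=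
  4 `^ (s / 2) * (Af * Ar * Z + Af * Ar * Z) + Bf * (4 `^ (s / 2) * (Ar * Z + Ar * Z)).

Definition freq_l1 (N : n.-tuple int) : R := \sum_(i < n) `|tnth N i|%:~R.

Lemma line_lip (N : n.-tuple int) (u v : R) :
  tdist (line N u) (line N v) <= freq_l1 N * `|u - v|.
Proof.
apply: le_trans (tdist_le_sum _ _) _; rewrite /freq_l1 mulr_suml; apply: ler_sum => i _.
by rewrite !tnth_mktuple (le_trans (distZ_le_norm _))// -mulrBr normrM intr_norm.
Qed.

Lemma line_closed (N : n.-tuple int) : tdist (line N 0) (line N 1 : n.-tuple R) = 0.
Proof.
apply/eqP; rewrite eq_le sqrtr_ge0 andbT (le_trans (tdist_le_sum _ _))//.
rewrite big1// => i _; rewrite !tnth_mktuple mulr0 mulr1 sub0r distZN -[X in distZ X]add0r.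
by rewrite distZD_int distZ0.
Qed.

(* The line is traversed with speed inversely proportional to rho; the normalization of
   the weight rho is itself controlled by the error of the line on rho * 1. *)
Lemma curve_quadrature (N : n.-tuple int) (S : R) : 0 <= S ->
  (forall r : seq (n.-tuple int), uniq r ->
     \sum_(k <- r) resonant R N k * (bessel R k `^ s)^-1 <= S ^+ 2) ->
  exists g : R -> n.-tuple R, lip_closed_curve (freq_l1 N * (M / m)) g /\
    forall phi, torus_buc phi -> hsb s phi Af -> (forall x, `|phi x| <= Bf) ->
      `|rint (fun x => phi x * rho x) - int01 (fun t => phi (g t) * 1)| <= quadC * S.
Proof.
move=> S0 hS.
have brho := torus_buc_buc trho.
have crho := @buc_line R n N _ brho.
pose c := int01 (fun t => rho (line N t)).
have cw : {within `[(0 : R), 1], continuous (fun t => rho (line N t))}.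
  exact: continuous_subspaceT.
have mc : m <= c.
  by rewrite -(int01_cst m); apply: le_int01 => //; exact: within_cst.
have cM : c <= M.
  by rewrite -(int01_cst M); apply: le_int01 => //; exact: within_cst.
have c0 : 0 < c by exact: lt_le_trans mc.
have M0 : 0 < M by exact: lt_le_trans cM.
pose p t := rho (line N t) / c.
have cp : continuous p by move=> t; apply: cvgM; [exact: crho|exact: cvg_cst].
have p1 : int01 p = 1.
  have -> : p = fun t => c^-1 * rho (line N t) + 0 * rho (line N t).
    by apply/funext => t; rewrite mul0r addr0 mulrC.
  by rewrite int01_lin// mul0r addr0 mulVf// gt_eqF.
have mp t : m / M <= p t.
  rewrite /p ler_pM ?invr_ge0 ?(ltW m0) ?(ltW M0)//.
  by rewrite lef_pV2 ?posrE.
have mM0 : 0 < m / M by rewrite divr_gt0.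
have [tau [tau0 tau1 tau01 taul tauI]] := reparametrize cp mM0 mp p1.
have N0 : 0 <= freq_l1 N by apply: sumr_ge0 => i _; rewrite ler0z.
have L0 : 0 <= freq_l1 N * (M / m) by rewrite mulr_ge0// divr_ge0// ltW.
have lip : lip_closed_curve (freq_l1 N * (M / m)) (fun u => line N (tau u)).
  split; first by rewrite tau0 tau1 line_closed.
  move=> u v u01 v01; apply: le_trans (line_lip _ _ _) _.
  rewrite -mulrA ler_wpM2l//.
  by rewrite -invf_div ler_pdivlMl// taul.
exists (fun u => line N (tau u)); split => // phi tphi hphi phiB.
have adm1 : admissible (freq_l1 N * (M / m)) 0 (fun u => line N (tau u)) (fun=> 1 : R).
  split; [exact: lip.2|by move=> *; rewrite subrr normr0 mul0r|].
  by move=> *; rewrite ler01 lerDl lexx.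
have cphi : {within `[(0 : R), 1], continuous ((fun t => phi (line N t)) \o tau)}.
  have := admissible_continuous L0 (lexx 0) tphi adm1; congr {within _, continuous _}.
  by apply/funext => t; exact: mulr1.
have bphi := torus_buc_buc tphi.
have cpr : {within `[(0 : R), 1], continuous (fun t => phi (line N t) * rho (line N t))}.
  exact/continuous_subspaceT/(@buc_line R n N _ (buc_mul bphi brho)).
have -> : int01 (fun t => phi (line N (tau t)) * 1) =
    c^-1 * int01 (fun t => phi (line N t) * rho (line N t)).
  transitivity (int01 ((fun t => phi (line N t)) \o tau)).
    by congr int01; apply/funext => t; exact: mulr1.
  rewrite tauI// /p.
  have := int01_lin c^-1 0 cpr cpr; rewrite mul0r addr0 => <-.
  by congr int01; apply/funext => t; rewrite mul0r addr0; ring.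
set I := int01 _; set r := rint _.
have E1 : `|I - r| <= bilC s Z S Af Ar.
  have := @line_error_bilinear R n s s0 Z Z0 sumZ N S S0 hS phi rho Af Ar.
  by apply.
have E2 : `|c - 1| <= bilC s Z S Ar 1.
  have := @line_error_bilinear R n s s0 Z Z0 sumZ N S S0 hS rho (fun=> 1) Ar 1.
  move=> /(_ Ar0 ler01 trho (@torus_buc_cst R n 1) hrho (@hsb_one R n s)).
  rewrite /line_error; under eq_fun do rewrite mulr1.
  by rewrite [X in rint X](_ : _ = rho) ?rho1//; apply/funext => x; rewrite mulr1.
(* This is an average of phi along the line with the positive weight rho / c of mass one. *)
have Ic : `|c^-1 * I| <= Bf.
  rewrite normrM gtr0_norm ?invr_gt0// ler_pdivrMl//.
  rewrite -[I]subr0 -(int01_cst 0) mulrC.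
  have cB : {within `[(0 : R), 1], continuous (fun t => Bf * rho (line N t))}.
    by apply: within_mul => //; exact: within_cst.
  have cB' : Bf * c = int01 (fun t => Bf * rho (line N t)).
    have := int01_lin Bf 0 cw cw; rewrite mul0r addr0 => <-.
    by congr int01; apply/funext => t; rewrite mul0r addr0.
  have bd t : `|phi (line N t) * rho (line N t)| <= Bf * rho (line N t).
    have r0 : 0 <= rho (line N t) by rewrite (le_trans (ltW m0)).
    by rewrite normrM (ger0_norm r0) ler_wpM2r.
  rewrite int01_cst subr0 cB' ler_norml; apply/andP; split.
    rewrite -mulN1r -[leLHS]addr0 -[X in _ + X](mul0r (int01 (fun t => Bf * rho (line N t)))).
    rewrite -int01_lin//; apply: le_int01 => //; first exact: within_lin.
    by move=> t _; have := bd t; rewrite ler_norml mul0r addr0 mulN1r => /andP[].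
  by apply: le_int01 => // t _; apply: le_trans (bd t); exact: ler_norm.
(* Separates the line error on phi * rho from the normalization error c - 1, where 1 is the integral
   of rho. *)
have -> : r - c^-1 * I = (r - I) + (c^-1 * I) * (c - 1).
  by field; rewrite gt_eqF.
apply: le_trans (ler_normD _ _) _; rewrite distrC normrM.
apply: (@le_trans _ _ (bilC s Z S Af Ar + Bf * bilC s Z S Ar 1)).
  by rewrite lerD// ler_pM.
rewrite /bilC /quadC le_eqVlt; apply/orP; left; apply/eqP.
by rewrite mulr1; move: (4 `^ (s / 2)) => q; ring.
Qed.

End Quadrature.

(** * Bounds on the data, the two classes of curves, and the rate *)

Section ProblemData.
Variables (R : realType) (d : nat).

(** The reciprocal of rho is periodic and continuous, hence bounded, which bounds rho away from
    zero. *)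
Lemma positive_lower_bound (rho : d.-tuple R -> R) : torus_periodic rho ->
  tcontinuous rho -> (forall x, 0 < rho x) -> exists2 m : R, 0 < m & forall x, m <= rho x.
Proof.
move=> prho crho rho0.
have [[B HB] _] : torus_buc (fun x => (rho x)^-1).
  apply: tcont_torus_buc; first by move=> x k; rewrite prho.
  move=> x e e0; have weight_of := rho0 x.
  (* The first entry forces rho y >= rho x / 2; the second then makes the difference of reciprocals
     smaller than e. *)
  pose e' := Num.min (rho x / 2) (e * (rho x * (rho x / 2))).
  have e'0 : 0 < e' by rewrite lt_min divr_gt0//= !mulr_gt0.
  have [del del0 h] := crho x e' e'0; exists del => // y /h xy.
  have ry := rho0 y.
  have h1 : `|rho x - rho y| < rho x / 2 by rewrite (lt_le_trans xy)// ge_min lexx.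
  have h2 : `|rho x - rho y| < e * (rho x * (rho x / 2)).
    by rewrite (lt_le_trans xy)// ge_min lexx orbT.
  have y2 : rho x / 2 <= rho y by move: h1; rewrite ltr_norml => /andP[_]; lra.
  have -> : (rho x)^-1 - (rho y)^-1 = (rho y - rho x) / (rho x * rho y).
    by field; rewrite !gt_eqF.
  rewrite normrM distrC [X in _ * X]gtr0_norm ?invr_gt0 ?mulr_gt0//.
  rewrite ltr_pdivrMr ?mulr_gt0//; apply: lt_le_trans h2 _.
  by rewrite ler_pM2l// ler_pM2l.
have B0 : 0 < B + 1.
  by rewrite ltr_wpDl// (le_trans _ (HB [tuple 0 | i < d])).
exists (B + 1)^-1; first by rewrite invr_gt0.
move=> x; have weight_of := rho0 x.
rewrite -[leRHS]invrK lef_pV2 ?posrE ?invr_gt0//.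
by rewrite (le_trans (ler_norm _))// (le_trans (HB x))// lerDl.
Qed.

Lemma lip_weight1 (l : R) : 0 <= l -> lip_weight l (fun=> 1).
Proof.
move=> l0; split=> [//||t t' _ _]; last by rewrite subrr normr0 mulr_ge0.
by have := int01E (@within_cst R `[0, 1]%classic 1); rewrite int01_cst.
Qed.

(** This identifies unweighted curves with weighted ones of weight constant l = 0, so
    [exists_minimizer] covers them. *)
Lemma lip_weight0 (r : R -> R) : lip_weight 0 r -> forall t, t \in `[0, 1] -> r t = 1.
Proof.
move=> w t t01; case: (w) => _ r1 rl.
have E u : u \in `[0, 1] -> r u = r t.
  move=> u01; have := rl u t u01 t01.
  by rewrite mul0r normr_le0 subr_eq0 => /eqP.
have I := int01E (@within_cst R `[0, 1]%classic (r t)); rewrite int01_cst in I.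
apply: EFin_inj; rewrite -I -r1.
by apply: eq_integral => u; rewrite inE/= => /E ->.
Qed.

Lemma lip_closed_curve_le (L L' : R) (g : R -> d.-tuple R) : L' <= L ->
  lip_closed_curve L' g -> lip_closed_curve L g.
Proof.
move=> LL [g01 gL]; split=> // t t' t01 t'01.
by rewrite (le_trans (gL _ _ t01 t'01))// ler_wpM2r.
Qed.

Lemma discKE (K : d.-tuple R -> d.-tuple R -> R) (rho : d.-tuple R -> R) (L l : R) g r :
  0 <= L -> 0 <= l -> torus_buc rho -> (forall phi, (Knorm K phi <= 1)%E -> torus_buc phi) ->
  lip_closed_curve L g -> lip_weight l r ->
  discK K (dens_int rho) (curve_int g r) =
  disc [set phi | (Knorm K phi <= 1)%E] (fun phi => rint (fun x => phi x * rho x)) g r.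
Proof.
move=> L0 l0 trho tPhi gL rl; congr ereal_sup; apply: eq_imagel => phi /= /tPhi tphi.
have a := lip_adm l0 gL rl.
rewrite /dens_int /curve_int tint_rint; last by apply: buc_mul; exact: torus_buc_buc.
by rewrite int01E//; exact: (admissible_continuous L0 l0 tphi a).
Qed.

Lemma korobov_tuple1 (q : nat) : (0 < d)%N -> (0 < q)%N ->
  freq_l1 R (korobov d q) <= d%:R * q%:R ^+ d.-1.
Proof.
move=> d0 q0; have -> : d%:R * q%:R ^+ d.-1 = \sum_(i < d) (q%:R : R) ^+ d.-1.
  by rewrite sumr_const card_ord [LHS]mulr_natl.
apply: ler_sum => i _; rewrite tnth_mktuple ger0_norm//.
by rewrite -[leLHS]/((q ^ i)%:R) -natrX ler_nat leq_pexp2l// -ltnS prednK.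
Qed.

End ProblemData.

Theorem theorem8 (R : realType) (d : nat) (s : R)
  (K : d.-tuple R -> d.-tuple R -> R) (rho : d.-tuple R -> R) :
  (2 <= d)%N ->
  d%:R / 2 < s ->
  (* K continuous symmetric positive definite kernel on T^d *)
  kcontinuous K -> periodic_kernel K -> symmetric_kernel K -> posdef_kernel K ->
  (* H_K(T^d) = H^s(T^d) with equivalent norms *)
  (exists c1 c2 : R, 0 < c1 /\ 0 < c2 /\
     (forall f, (Knorm K f < +oo)%E ->
        in_Hs s f /\ ((hs_norm s f)%:E <= c2%:E * Knorm K f)%E) /\
     (forall f, in_Hs s f -> exists g,
        tint (fun x => `|f x - g x|%:E) = 0%E /\
        (Knorm K g <= (c1 * hs_norm s f)%:E)%E)) ->
  (* mu = rho dx probability measure with positive density rho in H^s *)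
  torus_periodic rho -> tcontinuous rho -> (forall x, 0 < rho x) ->
  tint (fun x => (rho x)%:E) = 1%E ->
  in_Hs s rho ->
  exists c : R, 0 < c /\
    forall L : R, 1 <= L ->
      exists (g1 : R -> d.-tuple R) (r1 : R -> R) (g2 : R -> d.-tuple R),
        [/\ lip_closed_curve L g1 /\ lip_weight L r1,
            lip_closed_curve L g2,
            (* g1, r1 attains the min over P^Acurve_L *)
            (forall g r, lip_closed_curve L g -> lip_weight L r ->
               (discK K (dens_int rho) (curve_int g1 r1)
                 <= discK K (dens_int rho) (curve_int g r))%E),
            (* g2 attains the min over P^Lcurve_L *)
            (forall g, lip_closed_curve L g ->
               (discK K (dens_int rho) (curve_int g2 (fun _ : R => 1%R))
                 <= discK K (dens_int rho) (curve_int g (fun _ : R => 1%R)))%E) &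
            (discK K (dens_int rho) (curve_int g1 r1)
               <= discK K (dens_int rho) (curve_int g2 (fun _ : R => 1%R)))%E /\
            (discK K (dens_int rho) (curve_int g2 (fun _ : R => 1%R))
               <= (c * L `^ (- (s / (d%:R - 1))))%:E)%E].
Proof.
move=> d2 ds cK pK sK posK [c1 [c2 [c10 [c20 [HK _]]]]] prho crho rho0 rhoint Hrho.
have d0 : (0 < d)%N by exact: leq_trans d2.
have s0 : 0 <= s by rewrite ltW// (le_lt_trans _ ds)// divr_ge0.
have trho := tcont_torus_buc prho crho.
have [m m0 mrho] := positive_lower_bound prho crho rho0.
have [[M rhoM'] _] := trho.
have rhoM x : rho x <= M by rewrite (le_trans (ler_norm _)).
have M0 : 0 < M by rewrite (lt_le_trans (rho0 [tuple 0 | i < d])).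
have rho1 : rint rho = 1.
  by apply: EFin_inj; rewrite -tint_rint//; exact: torus_buc_buc.
have hrho := in_Hs_hsb trho Hrho; pose Ar := hs_norm s rho.
have Ar0 : 0 <= Ar by exact: sqrtr_ge0.
have [B B0 KB] := kernel_diag_bounded cK pK.
pose Phi := [set phi | (Knorm K phi <= 1)%E].
have kPhi phi : Phi phi -> kbound K phi 2 by exact: Knorm_kbound.
have tPhi phi : Phi phi -> torus_buc phi by move=> /kPhi; exact: kbound_torus_buc.
have bPhi phi : Phi phi -> forall x, `|phi x| <= 2 * B.
  by move=> /kPhi h x; exact: (kbound_le h KB).
have HPhi phi : Phi phi -> in_Hs s phi /\ hs_norm s phi <= c2.
  move=> P1; have [|h1 h2] := HK phi; first by rewrite (le_lt_trans P1)// ltry.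
  split=> //; rewrite -lee_fin; apply: le_trans h2 _.
  by rewrite -[leRHS]mule1 lee_pmul2l.
have pPhi phi : Phi phi -> torus_periodic phi by move=> /HPhi[[]].
have hPhi phi : Phi phi -> hsb s phi c2.
  move=> P1; have [h1 h2] := HPhi phi P1.
  exact: hsb_le (sqrtr_ge0 _) h2 (in_Hs_hsb (tPhi _ P1) h1).
have [G G0 HG] := lattice_summable d0 ds.
pose Z := Num.sqrt G; have Z0 : 0 <= Z by exact: sqrtr_ge0.
have sumZ (r : seq (d.-tuple int)) : uniq r -> \sum_(k <- r) (bessel R k `^ s)^-1 <= Z ^+ 2.
  move=> ur; rewrite sqr_sqrtr ?(ltW G0)//; apply: le_trans (HG r ur).
  apply: ler_sum => k _.
  have u1p : 0 < bracket R k by rewrite (lt_le_trans _ (bracket_ge1 R k)).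
  have uwp : 0 < bessel R k by rewrite (lt_le_trans _ (bessel_ge1 R k)).
  rewrite lef_pV2 ?posrE ?powR_gt0//.
  apply: ge0_ler_powR; rewrite ?nnegrE ?(ltW u1p) ?(ltW uwp)// lerD2l.
  have p2 := @pi_ge2 R; have p4 : 1 <= 4 * pi ^+ 2 :> R by rewrite expr2; nra.
  by rewrite ler_peMl// knorm2_ge0.
have B20 : 0 <= 2 * B by rewrite mulr_ge0.
have Q N S := @curve_quadrature R d s rho Ar c2 (2 * B) Z m M s0 Ar0 (ltW c20) Z0
  trho rho1 hrho m0 mrho rhoM sumZ N S.
pose C := quadC s Ar c2 (2 * B) Z.
have C0 : 0 <= C.
  by rewrite /C /quadC !(addr_ge0, mulr_ge0)// ?powR_ge0// ltW.
pose Ck := Num.sqrt ((d + d + 3)%:R `^ s * G); have Ck0 : 0 <= Ck by exact: sqrtr_ge0.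
pose p := s / (d%:R - 1).
have d1 : 0 < d%:R - 1 :> R by rewrite subr_gt0 ltr1n.
have p0 : 0 <= p by rewrite divr_ge0// ltW.
(* The reparametrized Korobov line has Lipschitz constant at most c0 q^(d-1), so L permits any q
   with q^(d-1) <= y = L / c0. *)
pose c0 := d%:R * (M / m).
have c00 : 0 < c0 by rewrite !mulr_gt0 ?invr_gt0 ?ltr0n.
(* [Z] serves the small L and Ck 2^s the Korobov lines, the power of 2 being the loss in rounding to
   an integer q. *)
pose W := Z + Ck * 2 `^ s; have W0 : 0 <= W by rewrite addr_ge0// mulr_ge0// powR_ge0.
pose cst := C * W * c0 `^ p + 1.
exists cst; split; first by rewrite ltr_wpDl// !mulr_ge0// powR_ge0.
move=> L L1; have L0 : 0 < L by rewrite (lt_le_trans _ L1).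
pose y := L / c0; have y0 : 0 < y by rewrite divr_gt0.
have yp0 : 0 < y `^ p by rewrite powR_gt0.
have Lp : C * W * (y `^ p)^-1 <= cst * L `^ (- p).
  have Ly : L = c0 * y by rewrite /y mulrC divfK// gt_eqF.
  have -> : (y `^ p)^-1 = c0 `^ p * L `^ (- p).
    rewrite powRN {1}Ly powRM ?(ltW c00) ?(ltW y0)// invfM mulrA mulfV ?mul1r//.
    by rewrite gt_eqF// powR_gt0.
  rewrite mulrA ler_wpM2r ?powR_ge0// lerDl ler01//.
have [g [gL gE]] : exists g, lip_closed_curve L g /\ forall phi, Phi phi ->
    `|rint (fun x => phi x * rho x) - int01 (fun t => phi (g t) * 1)| <= cst * L `^ (- p).
  (* For small L the constant curve, i.e. N = 0, is good enough. *)
  have [y1|y1] := ltP y 1.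
    have [|g [gL gE]] := Q (zero_freq d) Z Z0.
      move=> r ur; apply: le_trans (sumZ r ur); apply: ler_sum => k _.
      by rewrite ler_piMl ?invr_ge0 ?powR_ge0// /resonant lern1 leq_b1.
    exists g; split.
      apply: lip_closed_curve_le gL; rewrite /freq_l1 big1 ?mul0r ?(ltW L0)// => i _.
      by rewrite tnth_mktuple.
    move=> phi P1; apply: le_trans (gE phi (tPhi _ P1) (hPhi _ P1) (bPhi _ P1)) _.
    apply: le_trans Lp; rewrite -/C -mulrA ler_wpM2l//.
    apply: (@le_trans _ _ (W * 1)).
      by rewrite mulr1 lerDl mulr_ge0// powR_ge0.
    rewrite ler_wpM2l// invf_ge1//.
    have := ge0_ler_powR p0 (ltW y0) ler01 (ltW y1); rewrite powR1.
    by apply.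
  (* The real solution of x^(d-1) = y; q is its integer part, positive because y >= 1. *)
  pose x := y `^ (d%:R - 1)^-1.
  have x1 : 1 <= x.
    have i0 : 0 <= (d%:R - 1)^-1 :> R by rewrite invr_ge0 ltW.
    by have := ge0_ler_powR i0 ler01 (ltW y0) y1; rewrite powR1.
  have x0 : 0 <= x by rewrite (le_trans _ x1).
  pose q := Num.truncn x.
  have q0 : (0 < q)%N by rewrite truncn_gt0.
  have /andP[qx xq] := truncn_itv x0; rewrite -/q in qx xq.
  have qd : q%:R ^+ d.-1 <= y.
    have -> : y = x ^+ d.-1.
      rewrite -powR_mulrn// /x -powRrM -subn1 natrB// mulVf ?gt_eqF// powRr1//.
      exact: ltW.
    by rewrite lerXn2r ?nnegrE.
  have [||g [gL gE]] := Q (korobov d q) (Ck * (q%:R `^ s)^-1).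
  - by rewrite mulr_ge0// invr_ge0 powR_ge0.
  - by move=> r ur; exact: korobov_sum.
  exists g; split.
    apply: lip_closed_curve_le gL.
    apply: (@le_trans _ _ (d%:R * y * (M / m))); last first.
      by rewrite mulrAC -/c0 mulrC divfK// gt_eqF.
    rewrite ler_wpM2r ?divr_ge0 ?(ltW m0) ?(ltW M0)//.
    by rewrite (le_trans (korobov_tuple1 R d0 q0))// ler_wpM2l.
  move=> phi P1; apply: le_trans (gE phi (tPhi _ P1) (hPhi _ P1) (bPhi _ P1)) _.
  apply: le_trans Lp; rewrite -/C -mulrA ler_wpM2l//.
  apply: (@le_trans _ _ (Ck * 2 `^ s * (y `^ p)^-1)); last first.
    by rewrite ler_wpM2r ?invr_ge0 ?(ltW yp0)// lerDr.
  rewrite -mulrA ler_wpM2l//.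
  have -> : y `^ p = x `^ s by rewrite /x -powRrM mulrC.
  have xs : 0 < x `^ s by rewrite powR_gt0// (lt_le_trans _ x1).
  have qs : 0 < q%:R `^ s :> R by rewrite powR_gt0// ltr0n.
  rewrite ler_pdivlMr// ler_pdivrMl// -powRM//.
  apply: ge0_ler_powR; rewrite ?nnegrE ?mulr_ge0//.
  (* x < q + 1 <= 2 q since q >= 1. *)
  apply: le_trans (ltW xq) _; by rewrite -natrM ler_nat ?muln2 ?mul2n -addnn -addn1 leq_add2l.
pose a phi := rint (fun x => phi x * rho x).
have [g1 [r1 [g1L r1L min1]]] := exists_minimizer tPhi pPhi a (ltW L0) (ltW L0).
(* Weight constant 0: [r2] equals 1 on [0, 1], so [g2] is minimal among unweighted curves. *)
have [g2 [r2 [g2L r2L min2]]] := exists_minimizer tPhi pPhi a (ltW L0) (lexx 0).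
have w1 := lip_weight1 (ltW L0); have w0 := lip_weight1 (lexx 0).
have E2 : disc Phi a g2 r2 = disc Phi a g2 (fun=> 1).
  congr ereal_sup; apply: eq_imagel => phi _; congr (`|_ - _|%:E).
  by apply: eq_int01 => t t01; rewrite (lip_weight0 r2L t01).
have DE1 g' r' : lip_closed_curve L g' -> lip_weight L r' ->
    discK K (dens_int rho) (curve_int g' r') = disc Phi a g' r'.
  by move=> *; exact: (discKE (ltW L0) (ltW L0)).
exists g1, r1, g2; split => //.
- by move=> g' r' g'L r'L; rewrite !DE1//; exact: min1.
- by move=> g' g'L; rewrite !DE1// -E2; exact: min2.
split; first by rewrite !DE1//; exact: min1.
rewrite DE1// -E2; apply: (@le_trans _ _ (disc Phi a g (fun=> 1))); first exact: min2.
by apply: ge_ereal_sup => _ [phi P1 <-]; rewrite lee_fin; exact: gE.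
Qed.
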